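(* A morphism $i:V_\bullet\to W_\bullet$ in $\mathrm{Ch}(G)$ is a cofibration for the $I$-singular projective model structure if and only if it is a termwise split monomorphism whose cokernel is an $I$-exact sequence of $I$-projectives.
   Context: Let $k$ be a field of characteristic $p>0$ and $G$ a topological group (possibly discrete) admitting an open pro-$p$ subgroup $I$. $\mathrm{Rep}_k^\infty(G)$ is the category of smooth $k$-linear $G$-representations (stabilizers of vectors are open). $\mathbb{X}=\mathrm{ind}_I^G(k)$ is the space of compactly supported $f:G\to k$ with $f(gi)=f(g)$ for $i\in I$, with action $(gf)(g')=f(g^{-1}g')$; $H=\mathrm{End}_G(\mathbb{X})^{\mathrm{op}}$. $\mathrm{Ch}(H)$ and $\mathrm{Ch}(G)$ are the categories of unbounded chain complexes of left $H$-modules and of objects of $\mathrm{Rep}^\infty_k(G)$. $F=\mathbb{X}\otimes_H(\cdot)$ is left adjoint to $U=(\cdot)^I\cong\mathrm{Hom}_G(\mathbb{X},\cdot)$, termwise on complexes. A $G$-representation is $I$-projective if it is a direct summand of $FP$ for some projective $H$-module $P$. A sequence in $\mathrm{Rep}^\infty_k(G)$ is $I$-exact if it is a complex and becomes exact after applying $U$. The singular projective model structure on $\mathrm{Ch}(H)$ is the cofibrantly generated abelian model structure (due to Becker) in which: cofibrations are the monomorphisms with acyclic and termwise projective cokernel; fibrations are the epimorphisms; trivial objects are the complexes $Y$ with $\mathrm{Ext}^1_{\mathrm{Ch}(H)}(X,Y)=0$ for all termwise projective acyclic complexes $X$ (weak equivalences are the composites of a monomorphism with projective cokernel in $\mathrm{Ch}(H)$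 followed by an epimorphism with trivial kernel). The $I$-singular projective model structure on $\mathrm{Ch}(G)$ is its right transfer along $(F,U)$: $f$ is a fibration (resp. weak equivalence) iff $Uf$ is one in $\mathrm{Ch}(H)$; cofibrations are the maps with the left lifting property with respect to all trivial fibrations. *)

(* Defs.v *)
From HB Require Import structures.
From mathcomp Require Import all_boot all_order all_algebra.
From mathcomp Require Import finmap all_classical.
From mathcomp Require Import topology.

Set Implicit Arguments.
Unset Strict Implicit.
Unset Printing Implicit Defensive.

Import GRing.Theory.

Local Open Scope classical_set_scope.
Local Open Scope ring_scope.

Record preadditive := Preadditive {
  obj :> Type;
  mor : obj -> obj -> zmodType;
  idm : forall A, mor A A;
  mcomp : forall A B C, mor B C -> mor A B -> mor A C;
  compA : forall A B C D (h : mor C D) (g : mor B C) (f : mor A B),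
    mcomp h (mcomp g f) = mcomp (mcomp h g) f;
  comp1m : forall A B (f : mor A B), mcomp (idm B) f = f;
  compm1 : forall A B (f : mor A B), mcomp f (idm A) = f;
  compDl : forall A B C (g g' : mor B C) (f : mor A B),
    mcomp (g + g') f = mcomp g f + mcomp g' f;
  compDr : forall A B C (g : mor B C) (f f' : mor A B),
    mcomp g (f + f') = mcomp g f + mcomp g f'
}.

Arguments idm {p} A.
Arguments mcomp {p A B C} _ _.
Notation "g \oc f" := (mcomp g f) (at level 40, left associativity).

Section PreadditiveTheory.
Variable C : preadditive.
Implicit Types A B D : C.

Lemma comp0m A B D (f : mor A B) : (0 : mor B D) \oc f = 0.
Proof. by apply: (addrI (0 \oc f)); rewrite -compDl !addr0. Qed.

Lemma compm0 A B D (f : mor B D) : f \oc (0 : mor A B) = 0.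
Proof. by apply: (addrI (f \oc 0)); rewrite -compDr !addr0. Qed.

Lemma compNm A B D (g : mor B D) (f : mor A B) : (- g) \oc f = - (g \oc f).
Proof. by apply: (addrI (g \oc f)); rewrite -compDl !subrr comp0m. Qed.

Lemma compmN A B D (g : mor B D) (f : mor A B) : g \oc (- f) = - (g \oc f).
Proof. by apply: (addrI (g \oc f)); rewrite -compDr !subrr compm0. Qed.

Definition mono A B (f : mor A B) :=
  forall Z (g h : mor Z A), f \oc g = f \oc h -> g = h.

Definition epi A B (f : mor A B) :=
  forall Z (g h : mor B Z), g \oc f = h \oc f -> g = h.

Definition split_mono A B (f : mor A B) :=
  exists r : mor B A, r \oc f = idm A.

Definition split_epi A B (f : mor A B) :=
  exists s : mor B A, f \oc s = idm B.

Definition is_kernel A B K (f : mor A B) (k : mor K A) :=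
  f \oc k = 0 /\
  forall Z (g : mor Z A), f \oc g = 0 -> exists! g' : mor Z K, k \oc g' = g.

Definition is_cokernel A B Q (f : mor A B) (q : mor B Q) :=
  q \oc f = 0 /\
  forall Z (g : mor B Z), g \oc f = 0 -> exists! g' : mor Q Z, g' \oc q = g.

Definition short_exact A B D (j : mor A B) (q : mor B D) :=
  is_kernel q j /\ is_cokernel j q.

(* Ext^1(X, Y) = 0 for the Yoneda Ext: the class of an extension of X by Y
   is zero if and only if the extension splits. *)
Definition Ext1_zero (X Y : C) :=
  forall E (j : mor Y E) (q : mor E X), short_exact j q -> split_epi q.

Definition projective (P : C) :=
  forall A B (e : mor A B), epi e ->
  forall f : mor P B, exists g : mor P A, e \oc g = f.

Definition is_biproduct A B S
    (iA : mor A S) (iB : mor B S) (pA : mor S A) (pB : mor S B) :=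
  [/\ pA \oc iA = idm A, pB \oc iB = idm B, pA \oc iB = 0, pB \oc iA = 0
    & iA \oc pA + iB \oc pB = idm S].

Definition direct_summand A S :=
  exists B (iA : mor A S) (iB : mor B S) (pA : mor S A) (pB : mor S B),
    is_biproduct iA iB pA pB.

Definition has_llp A B X Y (i : mor A B) (f : mor X Y) :=
  forall (u : mor A X) (v : mor B Y), f \oc u = v \oc i ->
  exists l : mor B X, l \oc i = u /\ f \oc l = v.

Definition Endo (X : C) : Type := mor X X.

HB.instance Definition _ X := GRing.Zmodule.on (Endo X).

HB.instance Definition _ X := GRing.Zmodule_isPzRing.Build (Endo X)
  (@compA C X X X X) (@comp1m C X X) (@compm1 C X X)
  (fun f g h => @compDl C X X X f g h) (fun f g h => @compDr C X X X f g h).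

End PreadditiveTheory.

Record additive_functor (C D : preadditive) := AdditiveFunctor {
  fobj :> C -> D;
  fmap : forall A B, mor A B -> mor (fobj A) (fobj B);
  fmap1 : forall A, fmap (idm A) = idm (fobj A);
  fmapM : forall A B E (g : mor B E) (f : mor A B),
    fmap (g \oc f) = fmap g \oc fmap f;
  fmapD : forall A B (f g : mor A B), fmap (f + g) = fmap f + fmap g
}.

Arguments fmap {C D} a {A B} _.

Lemma fmap0 C D (F : additive_functor C D) (A B : C) :
  fmap F (0 : mor A B) = 0.
Proof. by apply: (addrI (fmap F 0)); rewrite -fmapD !addr0. Qed.

Section ModuleCategory.
Variable R : pzRingType.

Lemma linear_ext (M N : lmodType R) (f g : {linear M -> N}) : f =1 g -> f = g.
Proof.
move: f g => [f [[f1] [f2]]] [g [[g1] [g2]]] /= /funext E; subst g.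
by rewrite (Prop_irrelevance f1 g1) (Prop_irrelevance f2 g2).
Qed.

Definition mod_hom (M N : lmodType R) : Type := {linear M -> N}.

Lemma mod_hom_ext M N (f g : mod_hom M N) :
  (f : {linear M -> N}) =1 (g : {linear M -> N}) -> f = g.
Proof. exact: linear_ext. Qed.

HB.instance Definition _ M N := gen_eqMixin (mod_hom M N).
HB.instance Definition _ M N := gen_choiceMixin (mod_hom M N).

Section Hom.
Variables M N : lmodType R.
Implicit Types f g : mod_hom M N.

Definition mod_hom0 : mod_hom M N := \0 : {linear M -> N}.
Definition mod_homN f : mod_hom M N :=
  \- (f : {linear M -> N}) : {linear M -> N}.
Definition mod_homD f g : mod_hom M N :=
  (f : {linear M -> N}) \+ (g : {linear M -> N}) : {linear M -> N}.

Fact mod_homDA : associative mod_homD.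
Proof. by move=> f g h; apply: linear_ext => x /=; rewrite addrA. Qed.
Fact mod_homDC : commutative mod_homD.
Proof. by move=> f g; apply: linear_ext => x /=; rewrite addrC. Qed.
Fact mod_hom0D : left_id mod_hom0 mod_homD.
Proof. by move=> f; apply: linear_ext => x /=; rewrite add0r. Qed.
Fact mod_homND : left_inverse mod_hom0 mod_homN mod_homD.
Proof. by move=> f; apply: linear_ext => x /=; rewrite addNr. Qed.

HB.instance Definition _ := GRing.isZmodule.Build (mod_hom M N)
  mod_homDA mod_homDC mod_hom0D mod_homND.

End Hom.

Definition mod_id (M : lmodType R) : mod_hom M M := idfun : {linear M -> M}.
Definition mod_comp (M N P : lmodType R) (g : mod_hom N P) (f : mod_hom M N) :
    mod_hom M P :=
  ((g : {linear N -> P}) \o (f : {linear M -> N})) : {linear M -> P}.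

Program Definition Mod : preadditive := @Preadditive (lmodType R)
  (fun M N => GRing.Zmodule.clone (mod_hom M N) _) mod_id mod_comp _ _ _ _ _.
Next Obligation. by move=> *; exact: mod_hom_ext. Qed.
Next Obligation. by move=> *; exact: mod_hom_ext. Qed.
Next Obligation. by move=> *; exact: mod_hom_ext. Qed.
Next Obligation. by move=> *; exact: mod_hom_ext. Qed.
Next Obligation. by move=> *; apply: mod_hom_ext => x /=; rewrite linearD. Qed.

Definition mod_fun (M N : Mod) (f : mor M N) : {linear M -> N} := f.

End ModuleCategory.

(* R^c is the opposite ring of R, so precomposition with endomorphisms of X
   is a left action of (Endo X)^c. *)
Section HomFunctor.
Variables (C : preadditive) (X : C).

Definition homX (V : C) : Type := mor X V.

HB.instance Definition _ V := GRing.Zmodule.on (homX V).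

Definition homX_scale V (h : (Endo X)^c) (phi : homX V) : homX V :=
  (phi : mor X V) \oc h.

Section Scale.
Variable V : C.

Fact homX_scaleA (a b : (Endo X)^c) (v : homX V) :
  homX_scale a (homX_scale b v) = homX_scale (a * b) v.
Proof. by rewrite /homX_scale -compA. Qed.
Fact homX_scale1 : left_id 1 (@homX_scale V).
Proof. by move=> v; exact: compm1. Qed.
Fact homX_scaleDr : right_distributive (@homX_scale V) +%R.
Proof. by move=> a u v; exact: compDl. Qed.
Fact homX_scaleDl v : {morph (@homX_scale V)^~ v : a b / a + b}.
Proof. by move=> a b; exact: compDr. Qed.

HB.instance Definition _ := GRing.Zmodule_isLmodule.Build (Endo X)^c (homX V)
  homX_scaleA homX_scale1 homX_scaleDr homX_scaleDl.
End Scale.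

Section Map.
Variables (V W : C) (f : mor V W).
Definition homX_map (phi : homX V) : homX W := f \oc (phi : mor X V).

Fact homX_map_linear : linear homX_map.
Proof.
by move=> a u v; rewrite /homX_map [LHS]compDr; congr (_ + _); exact: compA.
Qed.
HB.instance Definition _ :=
  GRing.isLinear.Build (Endo X)^c (homX V) (homX W) _ homX_map homX_map_linear.
End Map.

Program Definition hom_functor : additive_functor C (Mod (Endo X)^c) :=
  @AdditiveFunctor C (Mod (Endo X)^c) (fun V => GRing.Lmodule.clone _ (homX V) _)
    (fun V W f => homX_map f : {linear homX V -> homX W}) _ _ _.
Next Obligation. by move=> *; apply: mod_hom_ext => x; exact: comp1m. Qed.
Next Obligation. by move=> *; apply: mod_hom_ext => x; exact/esym/compA. Qed.
Next Obligation. by move=> *; apply: mod_hom_ext => x; exact: compDl. Qed.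

End HomFunctor.

Section Chains.
Variable C : preadditive.

Record chain := Chain {
  cterm :> int -> C;
  bdry : forall n, mor (cterm (n + 1)) (cterm n);
  diffK : forall n, bdry n \oc bdry (n + 1) = 0
}.

Record chain_map (X Y : chain) := ChainMap {
  cmap :> forall n, mor (X n) (Y n);
  cmapP : forall n, cmap n \oc bdry X n = bdry Y n \oc cmap (n + 1)
}.

Lemma chain_map_ext X Y (f g : chain_map X Y) :
  (forall n, f n = g n) -> f = g.
Proof.
move: f g => [f f1] [g g1] /= E.
have {}E : f = g by exact: functional_extensionality_dep.
by subst g; rewrite (Prop_irrelevance f1 g1).
Qed.

HB.instance Definition _ X Y := gen_eqMixin (chain_map X Y).
HB.instance Definition _ X Y := gen_choiceMixin (chain_map X Y).

Section Hom.
Variables X Y : chain.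
Implicit Types f g : chain_map X Y.

Program Definition chain_map0 : chain_map X Y := @ChainMap X Y (fun n => 0) _.
Next Obligation. by move=> *; rewrite comp0m compm0. Qed.
Program Definition chain_mapN f : chain_map X Y :=
  @ChainMap X Y (fun n => - f n) _.
Next Obligation. by move=> *; rewrite compNm compmN cmapP. Qed.
Program Definition chain_mapD f g : chain_map X Y :=
  @ChainMap X Y (fun n => f n + g n) _.
Next Obligation. by move=> *; rewrite compDl compDr !cmapP. Qed.

Fact chain_mapDA : associative chain_mapD.
Proof. by move=> f g h; apply: chain_map_ext => x /=; rewrite addrA. Qed.
Fact chain_mapDC : commutative chain_mapD.
Proof. by move=> f g; apply: chain_map_ext => x /=; rewrite addrC. Qed.
Fact chain_map0D : left_id chain_map0 chain_mapD.
Proof. by move=> f; apply: chain_map_ext => x /=; rewrite add0r. Qed.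
Fact chain_mapND : left_inverse chain_map0 chain_mapN chain_mapD.
Proof. by move=> f; apply: chain_map_ext => x /=; rewrite addNr. Qed.

HB.instance Definition _ := GRing.isZmodule.Build (chain_map X Y)
  chain_mapDA chain_mapDC chain_map0D chain_mapND.

End Hom.

Program Definition chain_id X : chain_map X X :=
  @ChainMap X X (fun n => idm (X n)) _.
Next Obligation. by move=> *; rewrite comp1m compm1. Qed.

Program Definition chain_comp X Y Z (g : chain_map Y Z) (f : chain_map X Y) :
  chain_map X Z := @ChainMap X Z (fun n => g n \oc f n) _.
Next Obligation. by move=> *; rewrite -compA cmapP compA cmapP -compA. Qed.

Program Definition Ch : preadditive := @Preadditive chain
  (fun X Y => GRing.Zmodule.clone (chain_map X Y) _) chain_id chain_comp _ _ _ _ _.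
Next Obligation. by move=> *; apply: chain_map_ext => n /=; rewrite compA. Qed.
Next Obligation. by move=> *; apply: chain_map_ext => n /=; rewrite comp1m. Qed.
Next Obligation. by move=> *; apply: chain_map_ext => n /=; rewrite compm1. Qed.
Next Obligation. by move=> *; apply: chain_map_ext => n /=; rewrite compDl. Qed.
Next Obligation. by move=> *; apply: chain_map_ext => n /=; rewrite compDr. Qed.

Definition at_deg (X Y : Ch) (f : mor X Y) : forall n, mor (X n) (Y n) :=
  fun n => (f : chain_map X Y) n.

End Chains.

Section ChainFunctor.
Variables (C D : preadditive) (F : additive_functor C D).

Program Definition ch_obj (X : chain C) : chain D :=
  @Chain D (fun n => F (X n)) (fun n => fmap F (bdry X n)) _.
Next Obligation. by move=> *; rewrite -fmapM diffK fmap0. Qed.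

Program Definition ch_map X Y (f : chain_map X Y) :
    chain_map (ch_obj X) (ch_obj Y) :=
  @ChainMap D (ch_obj X) (ch_obj Y) (fun n => fmap F (f n)) _.
Next Obligation. by move=> *; rewrite -!fmapM cmapP. Qed.

Program Definition ch_functor : additive_functor (Ch C) (Ch D) :=
  @AdditiveFunctor (Ch C) (Ch D) ch_obj ch_map _ _ _.
Next Obligation. by move=> *; apply: chain_map_ext => n /=; rewrite fmap1. Qed.
Next Obligation. by move=> *; apply: chain_map_ext => n /=; rewrite fmapM. Qed.
Next Obligation. by move=> *; apply: chain_map_ext => n /=; rewrite fmapD. Qed.

End ChainFunctor.

HB.mixin Record isTopologicalGroup G of Group G & Topological G := {
  mulg_continuous : continuous (fun xy : (G * G)%type => (xy.1 * xy.2)%g);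
  invg_continuous : continuous (fun x : G => x^-1%g)
}.

#[short(type="topGroupType")]
HB.structure Definition TopologicalGroup :=
  {G of isTopologicalGroup G & Group G & Topological G}.

Section TopologicalGroupTheory.
Variable G : topGroupType.
Implicit Types (g x y : G) (A I N : set G).

Definition is_subgroup A :=
  A 1%g /\ forall x y, A x -> A y -> A (x * y^-1)%g.

Definition is_normal_in N I :=
  N `<=` I /\ forall x n, I x -> N n -> N (n ^ x)%g.

Definition lcosets_in I N : set (set G) :=
  [set [set (x * n)%g | n in N] | x in I].

Definition has_index I N (m : nat) := (lcosets_in I N #= `I_m)%card.

(* A profinite group is a compact Hausdorff group whose open subgroups form a
   base of neighbourhoods of 1; it is pro-p if all its open normal subgroups
   have index a power of p. As I is meant to be open in G, the open subsets
   of I are the open subsets of G contained in I. *)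
Definition profinite I :=
  [/\ compact I, hausdorff_space (set_type I)
    & forall A, nbhs 1%g A ->
      exists N, [/\ is_subgroup N, open N, N `<=` I & N `<=` A]].

Definition pro_p (p : nat) I :=
  profinite I /\
  forall N, is_subgroup N -> open N -> is_normal_in N I ->
    exists m, has_index I N (p ^ m)%N.

Lemma nbhs_mulg g (A : set G) x :
  nbhs x A -> nbhs (g * x)%g [set y | A (g^-1 * y)%g].
Proof.
move=> Ax.
have c : {for (g * x)%g, continuous (fun y => (g^-1 * y)%g : G)}.
  apply: (@continuous_comp _ _ _ (fun y => (g^-1, y)%g)
    (fun xy : (G * G)%type => (xy.1 * xy.2)%g)).
    by apply: cvg_pair => /=; [exact: cvg_cst | exact: cvg_id].
  exact: mulg_continuous.
by apply: c; rewrite /= mulKg.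
Qed.

Lemma nbhs_mulgr g (A : set G) x :
  nbhs x A -> nbhs (x * g)%g [set y | A (y * g^-1)%g].
Proof.
move=> Ax.
have c : {for (x * g)%g, continuous (fun y => (y * g^-1)%g : G)}.
  apply: (@continuous_comp _ _ _ (fun y => (y, g^-1)%g)
    (fun xy : (G * G)%type => (xy.1 * xy.2)%g)).
    by apply: cvg_pair => /=; [exact: cvg_id | exact: cvg_cst].
  exact: mulg_continuous.
by apply: c; rewrite /= mulgK.
Qed.

Lemma open_translate (S A : set G) : nbhs 1%g A ->
  (forall g a, S g -> A a -> S (g * a)%g) -> open S.
Proof.
move=> A1 SA; rewrite openE => g Sg.
have := nbhs_mulg g A1; rewrite mulg1; apply: filterS => y Ay.
by rewrite -[y](mulVKg g); exact: SA.
Qed.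

End TopologicalGroupTheory.

Record open_subgroup (G : topGroupType) := OpenSubgroup {
  osubg :> set G;
  osubg_open : open osubg;
  osubg_group : is_subgroup osubg
}.

Section Representations.
Variables (k : fieldType) (G : topGroupType).

Record smooth_rep := SmoothRep {
  rep_mod :> lmodType k;
  rep_act : G -> rep_mod -> rep_mod;
  rep_act_linear : forall g, linear (rep_act g);
  rep_act1 : forall v, rep_act 1%g v = v;
  rep_actM : forall g h v, rep_act (g * h)%g v = rep_act g (rep_act h v);
  rep_smooth : forall v, open [set g | rep_act g v = v]
}.

Arguments rep_act {s} g v.

Record rep_hom (V W : smooth_rep) := RepHom {
  rep_fun :> {linear V -> W};
  rep_funP : forall g v, rep_fun (rep_act g v) = rep_act g (rep_fun v)
}.

Lemma rep_hom_ext V W (f g : rep_hom V W) : f =1 g -> f = g.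
Proof.
move: f g => [f f1] [g g1] /= E.
have {}E : f = g by exact: linear_ext.
by subst g; rewrite (Prop_irrelevance f1 g1).
Qed.

HB.instance Definition _ V W := gen_eqMixin (rep_hom V W).
HB.instance Definition _ V W := gen_choiceMixin (rep_hom V W).

Lemma rep_act_zmod (V : smooth_rep) g : zmod_morphism (@rep_act V g).
Proof.
move=> u v; rewrite addrC -scaleN1r (rep_act_linear g (-1) v u).
by rewrite scaleN1r addrC.
Qed.

Lemma rep_act0 (V : smooth_rep) g : rep_act g (0 : V) = 0.
Proof. by rewrite -{1}(subrr (0 : V)) rep_act_zmod subrr. Qed.

Lemma rep_actN (V : smooth_rep) g (v : V) : rep_act g (- v) = - rep_act g v.
Proof. by rewrite -(add0r (- v)) rep_act_zmod rep_act0 add0r. Qed.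

Lemma rep_actD (V : smooth_rep) g (u v : V) :
  rep_act g (u + v) = rep_act g u + rep_act g v.
Proof. by rewrite -{1}(opprK v) rep_act_zmod rep_actN opprK. Qed.

Lemma rep_actZ (V : smooth_rep) g a (v : V) :
  rep_act g (a *: v) = a *: rep_act g v.
Proof. by rewrite -[a *: v]addr0 rep_act_linear rep_act0 addr0. Qed.

Section Hom.
Variables V W : smooth_rep.
Implicit Types f g : rep_hom V W.

Program Definition rep_hom0 : rep_hom V W :=
  @RepHom V W (\0 : {linear V -> W}) _.
Next Obligation. by move=> *; rewrite /= rep_act0. Qed.
Program Definition rep_homN f : rep_hom V W :=
  @RepHom V W (\- f : {linear V -> W}) _.
Next Obligation. by move=> *; rewrite /= rep_funP rep_actN. Qed.
Program Definition rep_homD f g : rep_hom V W :=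
  @RepHom V W (f \+ g : {linear V -> W}) _.
Next Obligation. by move=> *; rewrite /= !rep_funP rep_actD. Qed.

Fact rep_homDA : associative rep_homD.
Proof. by move=> f g h; apply: rep_hom_ext => x /=; rewrite addrA. Qed.
Fact rep_homDC : commutative rep_homD.
Proof. by move=> f g; apply: rep_hom_ext => x /=; rewrite addrC. Qed.
Fact rep_hom0D : left_id rep_hom0 rep_homD.
Proof. by move=> f; apply: rep_hom_ext => x /=; rewrite add0r. Qed.
Fact rep_homND : left_inverse rep_hom0 rep_homN rep_homD.
Proof. by move=> f; apply: rep_hom_ext => x /=; rewrite addNr. Qed.

HB.instance Definition _ := GRing.isZmodule.Build (rep_hom V W)
  rep_homDA rep_homDC rep_hom0D rep_homND.

End Hom.

Definition rep_id (V : smooth_rep) : rep_hom V V :=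
  @RepHom V V (idfun : {linear V -> V}) (fun _ _ => erefl).

Program Definition rep_comp U V W (g : rep_hom V W) (f : rep_hom U V) :
  rep_hom U W := @RepHom U W (g \o f : {linear U -> W}) _.
Next Obligation. by move=> *; rewrite /= !rep_funP. Qed.

Program Definition Rep : preadditive := @Preadditive smooth_rep
  (fun V W => GRing.Zmodule.clone (rep_hom V W) _) rep_id rep_comp _ _ _ _ _.
Next Obligation. by move=> *; apply: rep_hom_ext. Qed.
Next Obligation. by move=> *; apply: rep_hom_ext. Qed.
Next Obligation. by move=> *; apply: rep_hom_ext. Qed.
Next Obligation. by move=> *; apply: rep_hom_ext. Qed.
Next Obligation. by move=> *; apply: rep_hom_ext => x /=; rewrite linearD. Qed.

End Representations.

Arguments rep_act {k G s} g v.

Section Induction.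
Variables (k : fieldType) (G : topGroupType) (J : open_subgroup G).
Local Notation I := (osubg J).

Definition ind_pred : {pred (G -> k^o)} := fun f =>
  `[< (forall g i, I i -> f (g * i)%g = f g) /\
      compact (closure [set g | f g != 0]) >].

Definition ind := {f : G -> k^o | ind_pred f}.
HB.instance Definition _ := SubType.on ind.
HB.instance Definition _ := Choice.on ind.

Fact ind_submod : submod_closed ind_pred.
Proof.
split.
  apply/asboolP; split=> //.
  rewrite (_ : [set g | _] = set0) ?closure0; first exact: compact0.
  by rewrite -subset0 => g /=; rewrite eqxx.
move=> a f f' /asboolP[fI fc] /asboolP[f'I f'c]; apply/asboolP; split.
  by move=> g i Ii /=; rewrite !fctE fI// f'I.
apply: (subclosed_compact (@closed_closure _ _) (compactU fc f'c)).
rewrite -closureU; apply: closureS => g /=; rewrite !fctE.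
case: (eqVneq (f g) 0) => [->|?]; last by left.
by case: (eqVneq (f' g) 0) => [->|?]; [rewrite scaler0 addr0 eqxx | right].
Qed.
HB.instance Definition _ := GRing.isSubmodClosed.Build k (G -> k^o) ind_pred
  (GRing.submod_closed_semi ind_submod).
HB.instance Definition _ := [SubChoice_isSubLmodule of ind by <:].

Lemma indP (f : ind) : (forall g i, I i -> \val f (g * i)%g = \val f g) /\
  compact (closure [set g | \val f g != 0]).
Proof. by apply/asboolP; exact: (valP f). Qed.

Lemma osubgM x y : I x -> I y -> I (x * y)%g.
Proof.
case: (osubg_group J) => I1 IB Ix Iy.
by rewrite -[y]invgK; apply: (IB) => //; rewrite -[y^-1%g]mul1g; apply: (IB).
Qed.

Lemma osubgV x : I x -> I x^-1%g.
Proof.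
by case: (osubg_group J) => I1 IB Ix; rewrite -[x^-1%g]mul1g; apply: (IB).
Qed.

Lemma ind_supp_finite (f : ind) : exists s : seq G,
  forall g, \val f g != 0 -> exists2 x, x \in s & I (x^-1 * g)%g.
Proof.
pose G1 : ptopologicalType := HB.pack (TopologicalGroup.sort G)
  (isPointed.Build (TopologicalGroup.sort G) 1%g).
have [_ fc] := indP f; have : @compact G1 (closure [set g | \val f g != 0]).
  exact: fc.
rewrite compact_cover.
move=> /(_ G setT (fun x => [set g | I (x^-1 * g)%g])).
case=> [x _|g _|s _ fs].
- rewrite openE => g /= Ixg.
  have : nbhs (x^-1 * g)%g I.
    by apply: open_nbhs_nbhs; split=> //; exact: osubg_open.
  by move/(nbhs_mulg x); rewrite mulVKg.
- exists g => //=; rewrite mulVg; exact: (osubg_group J).1.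
exists (enum_fset s) => g fg.
have /fs[x /= xs Ix] : closure [set g | \val f g != 0] g by exact: subset_closure.
by exists x.
Qed.

Definition ind_translate (g : G) (f : G -> k^o) : G -> k^o :=
  fun x => f (g^-1 * x)%g.

Fact ind_translateP g (f : ind) : ind_pred (ind_translate g (\val f)).
Proof.
have [fI fc] := indP f; apply/asboolP; split.
  by move=> x i Ii; rewrite /ind_translate mulgA fI.
have cg : continuous (fun x : G => (g * x)%g).
  move=> x; apply: (@continuous_comp _ _ _ (fun y => (g, y)%g)
    (fun xy : (G * G)%type => (xy.1 * xy.2)%g)).
    by apply: cvg_pair => /=; [exact: cvg_cst | exact: cvg_id].
  exact: mulg_continuous.
have gc := continuous_compact (continuous_subspaceT cg) fc.
apply: (subclosed_compact (@closed_closure _ _) gc).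
move=> x cx; exists (g^-1 * x)%g; last exact: mulVKg.
move=> A /(nbhs_mulg g); rewrite mulVKg => /cx[y [/= fy Ay]].
by exists (g^-1 * y)%g.
Qed.

Definition ind_act g (f : ind) : ind := Sub _ (ind_translateP g f).

Fact ind_act_linear g : linear (ind_act g).
Proof. by move=> a u v; apply/val_inj. Qed.

Fact ind_act1 v : ind_act 1%g v = v.
Proof.
by apply/val_inj/funext => x; rewrite /= /ind_translate invg1 mul1g.
Qed.

Fact ind_actM g h v : ind_act (g * h)%g v = ind_act g (ind_act h v).
Proof.
by apply/val_inj/funext => x; rewrite /= /ind_translate invgM mulgA.
Qed.

Fact ind_smooth v : open [set g | ind_act g v = v].
Proof.
have [s sP] := ind_supp_finite v; have [vI _] := indP v.
pose A := [set g : G | forall x, x \in s -> I (x^-1 * (g * x))%g].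
have A1 : nbhs 1%g A.
  rewrite /A; elim: (s) => [|x t IH].
    by apply: filterS filterT => g _ x; rewrite inE.
  have nx : nbhs 1%g [set g | I (x^-1 * (g * x))%g].
    have : nbhs 1%g I.
      apply: open_nbhs_nbhs; split; [exact: osubg_open|].
      exact: (osubg_group J).1.
    move=> /(nbhs_mulg x)/(nbhs_mulgr x^-1%g).
    by rewrite mulg1 mulgV; apply: filterS => g /=; rewrite invgK.
  apply: filterS (filterI nx IH) => g [/= Ix It] y.
  by rewrite inE => /predU1P[->|/It].
have AV : forall a, A a -> A a^-1%g.
  by move=> a Aa x xs; have /osubgV := Aa x xs; rewrite !invgM invgK mulgA.
have Av1 a x : A a -> \val v x != 0 -> \val v (a^-1 * x)%g = \val v x.
  move=> /AV Aa /sP[y ys Iy].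
  have -> : (a^-1 * x = y * ((y^-1 * (a^-1 * y)) * (y^-1 * x)))%g.
    by rewrite -!mulgA mulVKg mulVKg.
  rewrite vI; last by apply: osubgM => //; exact: Aa.
  by rewrite -[in RHS](mulVKg y x) vI.
apply: (open_translate A1) => g a /= gv Aa.
rewrite ind_actM (_ : ind_act a v = v)//.
apply/val_inj/funext => x; rewrite /= /ind_translate.
have [vx|/Av1->//] := eqVneq (\val v x) 0.
apply/eqP; rewrite vx; apply/negPn/negP => vx'.
have := Av1 _ _ (AV _ Aa) vx'; rewrite invgK mulVKg vx => /eqP.
by rewrite eq_sym (negPf vx').
Qed.

Definition indX : Rep k G :=
  @SmoothRep k G ind ind_act ind_act_linear ind_act1 ind_actM ind_smooth.

Definition Hecke : pzRingType := (Endo indX)^c.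

(* functorU V is Hom_G(X, V); see U_invariants for its identification with V^I. *)
Definition functorU : additive_functor (Rep k G) (Mod Hecke) := hom_functor indX.

End Induction.

Section Frobenius.
Variables (k : fieldType) (G : topGroupType) (J : open_subgroup G).
Hypothesis J_compact : compact (osubg J).
Local Notation I := (osubg J).
Local Notation X := (indX k J).

Definition invariant (V : Rep k G) : set V :=
  [set v | forall i, I i -> rep_act i v = v].

Fact ind1P : ind_pred J (fun g => (`[< I g >])%:R : k^o).
Proof.
apply/asboolP; split.
  move=> g i Ii; congr (nat_of_bool _)%:R; apply/asboolP/asboolP => [|Ig].
    by move=> /osubgM/(_ (osubgV Ii)); rewrite mulgK.
  exact: osubgM.
have J_closed : closed I.
  rewrite -[I]setCK; apply: open_closedC.
  apply: (@open_translate _ _ I).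
    apply: open_nbhs_nbhs; split; [exact: osubg_open|].
    exact: (osubg_group J).1.
  by move=> g a nIg Ia Iga; apply/nIg; have /= := osubgM Iga (osubgV Ia); rewrite mulgK.
apply: (subclosed_compact (@closed_closure _ _) J_compact).
rewrite [X in _ `<=` X](closure_id _).1//; apply: closureS => g /=.
by case: asboolP => //; rewrite eqxx.
Qed.

Definition ind1 : X := Sub _ ind1P.

Let cos (x : G) : set G := [set y | I (x^-1 * y)%g].
Let rep (A : set G) : G := xget 1%g A.

Let cosP x y : cos x = cos y <-> I (x^-1 * y)%g.
Proof.
split=> [E|Ixy].
  have : cos x y by rewrite E /cos /= mulVg; exact: (osubg_group J).1.
  by [].
apply/seteqP; split=> z; rewrite /cos /= => Iz.
  by have := osubgM (osubgV Ixy) Iz; rewrite invgM invgK -mulgA mulVKg.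
by have := osubgM Ixy Iz; rewrite -mulgA mulVKg.
Qed.

Let cos_rep x : cos (rep (cos x)) = cos x.
Proof.
apply/esym/cosP; rewrite /rep.
have : exists y, cos x y.
  by exists x; rewrite /cos /= mulVg; exact: (osubg_group J).1.
exact: xgetPex.
Qed.

Let cover (f : X) (s : seq G) := forall g, \val f g != 0 ->
  exists2 x, x \in s & cos x = cos g.

Let cover_exists (f f' : X) :
  exists s, [/\ uniq (map cos s), cover f s & cover f' s].
Proof.
have [s sP] := ind_supp_finite f; have [s' s'P] := ind_supp_finite f'.
exists (map rep (undup (map cos (s ++ s')))); split.
- rewrite -map_comp (_ : map _ _ = undup (map cos (s ++ s'))) ?undup_uniq//.
  rewrite -[RHS]map_id; apply/eq_in_map => A; rewrite mem_undup.
  by case/mapP=> x _ -> /=; rewrite cos_rep.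
- move=> g /sP[x xs /cosP xg]; exists (rep (cos x)); last by rewrite cos_rep.
  by rewrite map_f// mem_undup map_f// mem_cat xs.
- move=> g /s'P[x xs /cosP xg]; exists (rep (cos x)); last by rewrite cos_rep.
  by rewrite map_f// mem_undup map_f// mem_cat xs orbT.
Qed.

Section Extension.
Variables (V : Rep k G) (v : V) (vI : invariant v).

Let phi (f : X) : V :=
  \sum_(A \in range cos) (\val f (rep A) : k) *: (rep_act (rep A) v : V).

Let phiE f s : uniq (map cos s) -> cover f s ->
  phi f = \sum_(x <- s) (\val f x : k) *: (rep_act x v : V).
Proof.
move=> us cs; rewrite /phi (fsbigE (map cos s))//=.
- rewrite big_map big_mkcond; apply: eq_big_seq => x xs /=.
  rewrite ifT; last by apply/mem_set; exists x.
  have /esym/cosP Ix := cos_rep x.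
  have -> : rep (cos x) = (x * (x^-1 * rep (cos x)))%g by rewrite mulVKg.
  by rewrite (indP f).1// rep_actM vI.
- by move=> _ /mapP[x _ ->]; exists x.
- move=> _ [z _ <-] zs; apply/eqP; rewrite scaler_eq0; apply/orP; left.
  apply/contraNT: zs => /cs[x xs]; rewrite cos_rep => <-; exact: map_f.
Qed.

Fact phi_linear : linear phi.
Proof.
move=> a f f'; have [s [us cf cf']] := cover_exists f f'.
rewrite (phiE us cf) (phiE us cf') (@phiE _ s)//.
  rewrite scaler_sumr -big_split; apply: eq_bigr => x _ /=.
  by rewrite scalerA -scalerDl.
move=> g; have [f0|/cf//] := eqVneq (\val f g) 0.
have [f0'|/cf'//] := eqVneq (\val f' g) 0.
by rewrite /= !fctE f0 f0' scaler0 addr0 eqxx.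
Qed.

Fact phi_act g f : phi (rep_act g f) = rep_act g (phi f).
Proof.
have [s [us cf _]] := cover_exists f f.
rewrite (phiE us cf) (@phiE _ (map (fun x => g * x)%g s)).
- rewrite big_map (big_morph _ (@rep_actD _ _ _ g) (@rep_act0 _ _ _ g)).
  apply: eq_bigr => x _; rewrite /= /ind_translate mulKg rep_actM.
  by rewrite rep_actZ.
- rewrite -map_comp; apply/(uniqP set0) => i j.
  rewrite !inE !size_map => si sj.
  rewrite !(nth_map 1%g) ?size_map//= => /cosP.
  rewrite invgM -!mulgA mulKg => /cosP E.
  by apply: (uniqP set0 us); rewrite ?inE ?size_map// !(nth_map 1%g).
- move=> y /cf[x xs /cosP Ix]; exists (g * x)%g; first exact: map_f.
  by apply/cosP; rewrite invgM -mulgA.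
Qed.

Fact phi1 : phi ind1 = v.
Proof.
rewrite (@phiE _ [:: 1%g])// ?big_seq1.
  rewrite rep_act1 /= asboolT ?scale1r//; exact: (osubg_group J).1.
move=> g /=; case: asboolP => [Ig _|]; last by rewrite eqxx.
by exists 1%g; rewrite ?mem_head//; apply/cosP; rewrite invg1 mul1g.
Qed.

Lemma frobenius_exists : exists f : functorU k J V, (f : rep_hom X V) ind1 = v.
Proof.
pose l := GRing.isLinear.Build k X V _ phi phi_linear.
pose L : {linear X -> V} := HB.pack phi l.
by exists (@RepHom k G X V L phi_act); exact: phi1.
Qed.

End Extension.

Lemma frobenius_inv (V : Rep k G) (f : functorU k J V) :
  invariant ((f : rep_hom X V) ind1).
Proof.
move=> i Ii; rewrite -rep_funP; congr (rep_fun _ _).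
apply/val_inj/funext => g; rewrite /= /ind_translate; congr (nat_of_bool _)%:R.
apply/asboolP/asboolP; last exact/osubgM/osubgV.
by move=> /(osubgM Ii); rewrite mulVKg.
Qed.

Lemma frobenius_inj (V : Rep k G) (f f' : functorU k J V) :
  (f : rep_hom X V) ind1 = (f' : rep_hom X V) ind1 -> f = f'.
Proof.
move=> E; apply: rep_hom_ext => x; have [s sP] := ind_supp_finite x.
elim: s x sP => [|y s IH] x sP.
  have -> : x = 0; last by rewrite !linear0.
  apply/val_inj/funext => g; apply/eqP/negPn/negP => /sP[] //.
pose x' : X := x - (\val x y : k) *: (rep_act y ind1 : X).
have /IH E' : forall g, \val x' g != 0 -> exists2 z, z \in s & I (z^-1 * g)%g.
  move=> g.
  have -> : \val x' g = \val x g - \val x y * (`[< I (y^-1 * g)%g >])%:R by [].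
  case: asboolP => Iyg.
    by rewrite mulr1 -{1}(mulVKg y g) (indP x).1// subrr eqxx.
  rewrite mulr0 subr0 => /sP[z]; rewrite inE => /predU1P[->//|zs Iz].
  by exists z.
have -> : x = x' + (\val x y : k) *: (rep_act y ind1 : X) by rewrite subrK.
by rewrite [LHS]linearD [RHS]linearD E' !linearZ !rep_funP E.
Qed.

Lemma U_invariants (V : Rep k G) :
  set_bij [set: functorU k J V] (@invariant V)
    (fun f => (f : rep_hom X V) ind1).
Proof.
split=> [f _|f f' _ _|v vI]; [exact: frobenius_inv|exact: frobenius_inj|].
by have [f fE] := frobenius_exists vI; exists f.
Qed.

End Frobenius.

(* X is a right H-module by x . h = h(x). As a set, X (x)_H P consists of the
   formal sums of pairs (x, m), two sums being identified when every balanced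
   map to an abelian group takes the same value on both; this is the quotient
   of the free commutative monoid on X * P through which all balanced maps
   factor, cf. tensorP below. *)
Section Tensor.
Variables (k : fieldType) (G : topGroupType) (J : open_subgroup G).
Local Notation X := (indX k J).
Local Notation H := (Hecke k J).
Variable P : lmodType H.

Definition X_mulr (x : X) (h : H) : X := (h : rep_hom X X) x.

Definition balanced (A : zmodType) (b : X -> P -> A) :=
  [/\ forall x x' m, b (x + x') m = b x m + b x' m,
      forall x m m', b x (m + m') = b x m + b x m'
    & forall x h m, b (X_mulr x h) m = b x (h *: m)].

Definition tens_eval (A : zmodType) (b : X -> P -> A) (s : seq (X * P)) : A :=
  \sum_(xm <- s) b xm.1 xm.2.

Definition tens_rel (s t : seq (X * P)) : bool :=
  `[< forall (A : zmodType) (b : X -> P -> A), balanced b ->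
        tens_eval b s = tens_eval b t >].

Fact tens_rel_refl : reflexive tens_rel.
Proof. by move=> s; apply/asboolP. Qed.
Fact tens_rel_sym : symmetric tens_rel.
Proof. by move=> s t; apply/asboolP/asboolP => E A b /E. Qed.
Fact tens_rel_trans : transitive tens_rel.
Proof.
move=> t s u /asboolP E /asboolP F; apply/asboolP => A b bb.
by rewrite E// F.
Qed.

Canonical tens_equiv :=
  EquivRel tens_rel tens_rel_refl tens_rel_sym tens_rel_trans.

Definition tensor := {eq_quot tens_equiv}%qT.
HB.instance Definition _ := Choice.on tensor.
HB.instance Definition _ := Quotient.on tensor.

Definition tens_of (s : seq (X * P)) : tensor := \pi_tensor%qT s.

Lemma tens_ofP s t : tens_of s = tens_of t <->
  forall (A : zmodType) (b : X -> P -> A), balanced b ->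
    tens_eval b s = tens_eval b t.
Proof. by split=> [/eqmodP/asboolP//|E]; apply/eqmodP/asboolP. Qed.

Lemma tens_ofK (t : tensor) : tens_of (repr t) = t.
Proof. exact: reprK. Qed.

Lemma tens_eval_repr s (A : zmodType) b : @balanced A b ->
  tens_eval b (repr (tens_of s)) = tens_eval b s.
Proof. by move=> bb; apply: (tens_ofP _ _).1 bb; rewrite tens_ofK. Qed.

Lemma tens_eval_cat (A : zmodType) (b : X -> P -> A) s t :
  tens_eval b (s ++ t) = tens_eval b s + tens_eval b t.
Proof. exact: big_cat. Qed.

Definition tens_map (f : X -> X) (s : seq (X * P)) :=
  [seq (f xm.1, xm.2) | xm <- s].

Lemma tens_eval_map (A : zmodType) (b : X -> P -> A) f s :
  tens_eval b (tens_map f s) = tens_eval (fun x => b (f x)) s.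
Proof. by rewrite /tens_eval big_map. Qed.

Lemma balanced_map (A : zmodType) (b : X -> P -> A) (f : X -> X) : balanced b ->
  (forall x y, f (x + y) = f x + f y) ->
  (forall x h, f (X_mulr x h) = X_mulr (f x) h) ->
  balanced (fun x => b (f x)).
Proof.
move=> [bDl bDr bM] fD fM.
by split=> [x x' m|x m m'|x h m]; rewrite ?fD ?fM.
Qed.

Definition tens_add (t u : tensor) : tensor := tens_of (repr t ++ repr u).
Definition tens_lmap (f : X -> X) (t : tensor) : tensor :=
  tens_of (tens_map f (repr t)).

Let tens_eq (t u : tensor) :
  (forall (A : zmodType) b, @balanced A b ->
     tens_eval b (repr t) = tens_eval b (repr u)) ->
  t = u.
Proof. by move=> E; rewrite -[t]tens_ofK -[u]tens_ofK; apply/tens_ofP. Qed.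

Let tens_eval_add (A : zmodType) b t u : @balanced A b ->
  tens_eval b (repr (tens_add t u)) =
  tens_eval b (repr t) + tens_eval b (repr u).
Proof. by move=> bb; rewrite tens_eval_repr// tens_eval_cat. Qed.

Let tens_eval_lmap (A : zmodType) b f t : @balanced A b ->
  tens_eval b (repr (tens_lmap f t)) = tens_eval (fun x => b (f x)) (repr t).
Proof. by move=> bb; rewrite tens_eval_repr// tens_eval_map. Qed.

Fact tens_addA : associative tens_add.
Proof. by move=> t u v; apply: tens_eq => A b bb; rewrite !tens_eval_add// addrA. Qed.
Fact tens_addC : commutative tens_add.
Proof. by move=> t u; apply: tens_eq => A b bb; rewrite !tens_eval_add// addrC. Qed.
Fact tens_add0 : left_id (tens_of [::]) tens_add.
Proof.
move=> t; apply: tens_eq => A b bb.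
by rewrite tens_eval_add// tens_eval_repr// /tens_eval big_nil add0r.
Qed.
Fact tens_addN : left_inverse (tens_of [::]) (tens_lmap -%R) tens_add.
Proof.
move=> t; apply: tens_eq => A b bb; have [bD _ _] := bb.
rewrite tens_eval_add// tens_eval_lmap// tens_eval_repr//.
rewrite /tens_eval big_nil -big_split big1//= => xm _.
have b0 m : b 0 m = 0 by apply: (addrI (b 0 m)); rewrite -bD !addr0.
by rewrite -bD addNr b0.
Qed.

HB.instance Definition _ := GRing.isZmodule.Build tensor
  tens_addA tens_addC tens_add0 tens_addN.

Let balanced_scale (A : zmodType) (b : X -> P -> A) (a : k) :
  balanced b -> balanced (fun x => b (a *: x)).
Proof.
move=> bb; apply: balanced_map => // [x y|x h]; first exact: scalerDr.
by rewrite /X_mulr linearZ.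
Qed.

Let balanced_act (A : zmodType) (b : X -> P -> A) (g : G) :
  balanced b -> balanced (fun x => b (rep_act g x)).
Proof.
move=> bb; apply: balanced_map => // [x y|x h]; first exact: rep_actD.
by rewrite /X_mulr rep_funP.
Qed.

Definition tens_scale (a : k) : tensor -> tensor := tens_lmap ( *:%R a).

Fact tens_scaleA a b t : tens_scale a (tens_scale b t) = tens_scale (a * b) t.
Proof.
apply: tens_eq => A c cb; rewrite !tens_eval_lmap//; last exact: balanced_scale.
by apply: eq_bigr => xm _; rewrite scalerA.
Qed.
Fact tens_scale1 : left_id 1 tens_scale.
Proof.
move=> t; apply: tens_eq => A b bb; rewrite !tens_eval_lmap//.
by apply: eq_bigr => xm _; rewrite scale1r.
Qed.
Fact tens_scaleDr : right_distributive tens_scale +%R.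
Proof.
move=> a t u; apply: tens_eq => A b bb.
rewrite tens_eval_lmap// [LHS]tens_eval_add; last exact: balanced_scale.
by rewrite [RHS]tens_eval_add// !tens_eval_lmap.
Qed.
Fact tens_scaleDl t : {morph tens_scale^~ t : a b / a + b}.
Proof.
move=> a a'; apply: tens_eq => A b bb; have [bD _ _] := bb.
rewrite [RHS]tens_eval_add// !tens_eval_lmap// -big_split.
by apply: eq_bigr => xm _; rewrite scalerDl bD.
Qed.

HB.instance Definition _ := GRing.Zmodule_isLmodule.Build k tensor
  tens_scaleA tens_scale1 tens_scaleDr tens_scaleDl.

Definition tens_act (g : G) : tensor -> tensor := tens_lmap (rep_act g).

Fact tens_act_linear g : linear (tens_act g).
Proof.
move=> a t u; apply: tens_eq => A b bb.
have gb := balanced_act g bb.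
rewrite tens_eval_lmap// [LHS]tens_eval_add// [in LHS]tens_eval_lmap//.
rewrite [RHS]tens_eval_add// [X in _ = X + _]tens_eval_lmap//.
rewrite !tens_eval_lmap//; last exact: balanced_scale.
congr (_ + _); apply: eq_bigr => xm _; congr b.
exact: rep_actZ.
Qed.

Fact tens_act1 t : tens_act 1%g t = t.
Proof.
apply: tens_eq => A b bb; rewrite tens_eval_lmap//.
by apply: eq_bigr => xm _; rewrite rep_act1.
Qed.

Fact tens_actM g h t : tens_act (g * h)%g t = tens_act g (tens_act h t).
Proof.
apply: tens_eq => A b bb; rewrite !tens_eval_lmap//; last exact: balanced_act.
by apply: eq_bigr => xm _; rewrite rep_actM.
Qed.

Fact tens_smooth t : open [set g | tens_act g t = t].
Proof.
pose N := [set g : G | tens_map (rep_act g) (repr t) = repr t].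
have N1 : nbhs 1%g N.
  rewrite /N; elim: (repr t) => [|[x m] s IH].
    by apply: filterS filterT.
  have x1 : nbhs 1%g [set g | rep_act g x = x].
    by apply: open_nbhs_nbhs; split; [exact: rep_smooth|exact: rep_act1].
  by apply: filterS (filterI x1 IH) => g [/= -> ->].
apply: (open_translate N1) => g a /= gt Na.
rewrite tens_actM (_ : tens_act a t = t)//.
by rewrite /tens_act /tens_lmap Na tens_ofK.
Qed.

Definition functorF : Rep k G := @SmoothRep k G tensor
  tens_act tens_act_linear tens_act1 tens_actM tens_smooth.

Definition tens (x : X) (m : P) : functorF := tens_of [:: (x, m)].

Lemma tens_balanced : balanced tens.
Proof.
split=> [x x' m|x m m'|x h m]; apply: tens_eq => A b bb; have [bDl bDr bM] := bb.
- by rewrite [RHS]tens_eval_add// !tens_eval_repr// /tens_eval !big_seq1 bDl.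
- by rewrite [RHS]tens_eval_add// !tens_eval_repr// /tens_eval !big_seq1 bDr.
- by rewrite !tens_eval_repr// /tens_eval !big_seq1 bM.
Qed.

Lemma tens_gen (t : functorF) : t = tens_eval tens (repr t).
Proof.
rewrite -[LHS]tens_ofK; elim: (repr t) => [|[x m] s IH].
  by rewrite /tens_eval big_nil.
rewrite /tens_eval big_cons -/(tens_eval _ _) -IH; apply: tens_eq => A b bb.
rewrite [RHS]tens_eval_add// !tens_eval_repr//.
by rewrite /tens_eval big_cons big_seq1.
Qed.

Lemma tens_actE g x m : rep_act g (tens x m) = tens (rep_act g x) m.
Proof.
apply: tens_eq => A b bb; rewrite tens_eval_lmap// !tens_eval_repr//.
  by rewrite /tens_eval !big_seq1.
exact: balanced_act.
Qed.

Lemma tens_scaleE a x m : a *: tens x m = tens (a *: x) m.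
Proof.
apply: tens_eq => A b bb; rewrite tens_eval_lmap// !tens_eval_repr//.
  by rewrite /tens_eval !big_seq1.
exact: balanced_scale.
Qed.

Lemma tensorP (A : zmodType) (b : X -> P -> A) : balanced b ->
  exists! f : functorF -> A, zmod_morphism f /\ forall x m, f (tens x m) = b x m.
Proof.
move=> bb; pose f (t : functorF) := tens_eval b (repr t).
have fD t u : f (t + u) = f t + f u by exact: tens_eval_add.
have fB : zmod_morphism f.
  by move=> t u; apply/(addIr (f u)); rewrite -fD !subrK.
exists f; split=> [|f' [f'B f'E]].
  by split=> // x m; rewrite /f tens_eval_repr// /tens_eval big_seq1.
apply/funext => t; rewrite [in RHS](tens_gen t) /f /tens_eval.
have f'0 : f' 0 = 0 by have := f'B 0 0; rewrite !subrr.
have f'D u v : f' (u + v) = f' u + f' v.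
  by have := f'B (u + v) v; rewrite addrK => ->; rewrite subrK.
by rewrite (big_morph f' f'D f'0); apply: eq_bigr => xm _.
Qed.

End Tensor.

Record model_classes (C : preadditive) := ModelClasses {
  cof : forall A B : C, mor A B -> Prop;
  fib : forall A B : C, mor A B -> Prop;
  weq : forall A B : C, mor A B -> Prop
}.

Arguments cof {C} m {A B} f.
Arguments fib {C} m {A B} f.
Arguments weq {C} m {A B} f.

Definition right_transfer (C D : preadditive) (R : additive_functor C D)
    (M : model_classes D) : model_classes C := {|
  cof := fun A B i => forall (Y Z : C) (f : mor Y Z),
    fib M (fmap R f) -> weq M (fmap R f) -> has_llp i f;
  fib := fun A B f => fib M (fmap R f);
  weq := fun A B f => weq M (fmap R f)
|}.

Section SingularProjective.
Variable R : pzRingType.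
Implicit Types X Y : Ch (Mod R).

(* Every integer is of the form n + 1, so this is exactness in all degrees. *)
Definition acyclic X := forall n (x : cterm X (n + 1)),
  mod_fun (bdry X n) x = 0 -> exists y, mod_fun (bdry X (n + 1)) y = x.

Definition acyclic_projective X := acyclic X /\ forall n, projective (X n).

Definition sp_trivial Y := forall X, acyclic_projective X -> Ext1_zero X Y.

Definition singular_projective : model_classes (Ch (Mod R)) := {|
  cof := fun A B i => mono i /\
    exists Q (q : mor B Q), is_cokernel i q /\ acyclic_projective Q;
  fib := fun A B f => epi f;
  weq := fun A B f => exists E (j : mor A E) (q : mor E B),
    [/\ f = q \oc j,
        mono j,
        exists Q (c : mor E Q), is_cokernel j c /\ projective Q,
        epi q
      & exists K (i : mor K E), is_kernel q i /\ sp_trivial K]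
|}.

End SingularProjective.

Section ISingularProjective.
Variables (k : fieldType) (G : topGroupType) (I : open_subgroup G).

Definition I_projective (V : Rep k G) :=
  exists P : Mod (Hecke k I), projective P /\ direct_summand V (functorF P).

Definition I_exact (X : Ch (Rep k G)) := acyclic (ch_functor (functorU k I) X).

Definition I_singular_projective : model_classes (Ch (Rep k G)) :=
  right_transfer (ch_functor (functorU k I)) (singular_projective (Hecke k I)).

End ISingularProjective.

(* Main.v *)
From HB Require Import structures.
From mathcomp Require Import all_boot all_order all_algebra.
From mathcomp Require Import all_classical.
From mathcomp Require Import topology.
Require Import Defs.

Set Implicit Arguments.
Unset Strict Implicit.
Unset Printing Implicit Defensive.

Import GRing.Theory Num.Theory Order.TTheory.

Local Open Scope classical_set_scope.
Local Open Scope ring_scope.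

(** The model structure is transferred along [U = Hom_G (X, -)], so [i] is a
    cofibration when it lifts against all [f] for which [U f] is a trivial
    fibration of complexes of modules over the Hecke algebra [H]. A map of
    complexes of [H]-modules is a trivial fibration when it is a termwise
    epimorphism whose kernel [K] has [Ext^1 (P, K) = 0] for all acyclic
    complexes [P] of projectives ([trivial_fibration_weq],
    [weq_trivial_fibration]). Since the extensions in question split termwise,
    this is a statement about cocycles of degree -1 from [P] to [K]: all of them
    are coboundaries.

    An [I]-projective representation [V] behaves like a projective [H]-module:
    [U V] is projective and [U] is bijective on maps out of [V]
    ([I_projective_U_projective]). This is because the unit [P -> U F P] is an
    isomorphism for projective [P], by reduction to free [P], where it holds
    since [X] is generated by one vector, so that maps from [X] to a direct sum
    of copies of [X] have finitely many components ([free_unit_iso]).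

    If [i] splits termwise and its cokernel [Q] is an [I]-exact complex of
    [I]-projectives, a lift against [f] exists in each degree. These lifts fail
    to form a chain map by a cocycle from [Q] to the kernel of [f]; under [U] it
    becomes a cocycle on an acyclic complex of projectives, hence a coboundary,
    and the lifts can be corrected ([split_mono_lifts]).

    Conversely let [i] be a cofibration. Lifting against sums of disks is
    lifting in all degrees separately ([termwise_lift]). Applied to [V n -> 0]
    it splits [i] termwise; applied to maps [F L -> Q n] with [L] free that
    become surjective under [U] it shows that the terms of [Q] are
    [I]-projective. It remains to see that [U Q] is acyclic ([lifts_acyclic]).
    The lifting property of [i] against split extensions gives that every
    cocycle from [Q] to [Y] is a coboundary, provided that [U Y] is trivial
    ([lifts_coboundary]). Homology of [U Q] would be detected by maps to an
    injective module [J], that is, by taking for [U Y] the complex with the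
    single term [J]; but [J] need not be a value of [U]. However, [J] has a
    projective resolution with terms [U V] for [I]-projective [V], which
    therefore is of the form [U Y] ([U_resolution_exists]), and a complex of
    projectives cannot tell it from [J] ([cocycle_exists], [coboundary_exists]).
    For [J] it suffices to take modules coinduced from the ground field [k],
    since linear maps to them are just [k]-linear maps ([coinduced_extends],
    [image_kernel]). *)

(** * Families indexed by the integers *)

Lemma dependent_choice (I : Type) (T : I -> Type) (P : forall i, T i -> Prop) :
  (forall i, exists x, P i x) -> exists f : forall i, T i, forall i, P i (f i).
Proof.
by move=> h; exists (fun i => projT1 (cid (h i))) => i; exact: (projT2 (cid _)).
Qed.

Lemma int_succ_ind (P : int -> Prop) : (forall n, P (n + 1)) -> forall n, P n.
Proof. by move=> h n; rewrite -[n](subrK 1); exact: h. Qed.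

Definition transport (T : int -> Type) m n (e : m = n) (x : T m) : T n :=
  eq_rect m T x n e.

(** Boundary maps are indexed by their target, so constructions naturally
    produce families over the degrees [n + 1]; this is where such a family is
    seen as one over all degrees, once and for all. *)
Lemma reindex_succ (T : int -> Type) (g : forall n, T (n + 1)) :
  exists f : forall n, T n, forall n, f (n + 1) = g n.
Proof.
exists (fun n => transport (subrK 1 n) (g (n - 1))) => n.
have E m k (mk : m = k) (e : m + 1 = k + 1) : transport e (g m) = g k.
  by case: k / mk e => e; rewrite (eq_axiomK e).
exact/E/addrK.
Qed.

(** Dependent choice from degree [n] upwards; [Good] is the invariant that makes
    the next step possible. *)
Lemma int_recursion (T : int -> Type) (Good : forall m, T m -> Prop)
    (R : forall m, T m -> T (m + 1) -> Prop) (dflt : forall m, T m)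
    n (x0 : T n) :
  Good n x0 ->
  (forall m x, n <= m -> Good m x -> exists y, Good (m + 1) y /\ R m x y) ->
  exists f : forall m, T m,
    [/\ f n = x0, forall m, m < n -> f m = dflt m
      & forall m, n <= m -> Good m (f m) /\ R m (f m) (f (m + 1))].
Proof.
move=> g0 step.
(* The iteration runs on pairs of a degree and an element in that degree. *)
pose nx m (x : T m) : T (m + 1) :=
  match pselect (exists y, Good (m + 1) y /\ R m x y) with
  | left h => projT1 (cid h) | right _ => dflt (m + 1) end.
pose next (u : {m & T m}) : {m & T m} :=
  existT T (tag u + 1) (nx (tag u) (tagged u)).
pose s i := iter i next (existT T n x0).
have sE m : n <= m -> tag (s `|m - n|%N) = m.
  move=> nm; have -> : m = n + `|m - n|%N%:Z.
    by rewrite gez0_abs ?subr_ge0// [RHS]addrC subrK.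
  rewrite addrAC subrr add0r absz_nat; elim: `|m - n|%N => [|i IH] /=.
    by rewrite addr0.
  by rewrite IH -addrA -PoszD addn1.
pose f m : T m := match pselect (n <= m) with
  | left nm => transport (sE m nm) (tagged (s `|m - n|%N))
  | right _ => dflt m end.
have fS m (nm : n <= m) :
    exists e : tag (s `|m - n|%N) = m, f m = transport e
      (tagged (s `|m - n|%N)).
  by rewrite /f; case: pselect => // nm'; exists (sE m nm').
have fn : f n = x0.
  have [] := fS n (lexx n); rewrite subrr /= => e ->.
  by rewrite (eq_axiomK e).
have fR m : n <= m -> Good m (f m) ->
    Good (m + 1) (f (m + 1)) /\ R m (f m) (f (m + 1)).
  move=> nm gm; have nm1 : n <= m + 1 by rewrite (le_trans nm)// lerDl.
  have [e fm] := fS m nm; have [e1 fm1] := fS (m + 1) nm1.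
  have E1 : `|(m + 1 - n)%R|%N = `|m - n|%N.+1.
    have mE : m - n = `|m - n|%N%:Z by rewrite gez0_abs ?subr_ge0.
    by rewrite addrAC {1}mE -PoszD absz_nat addn1.
  rewrite fm1; clear fm1.
  case: _ / (esym E1) e1 => /= e1.
  case: (s _) e e1 fm => m' x /= e; case: m / e nm gm nm1 E1 => nm gm nm1 E1 e1
    fm.
  rewrite (eq_axiomK e1) /= -[x]/(transport erefl x) -fm.
  by rewrite /nx; case: pselect => [h|[]];
    [exact: (projT2 (cid h)) | exact: step].
have fG m : n <= m -> Good m (f m).
  move=> nm; have -> : m = n + `|m - n|%N%:Z.
    by rewrite gez0_abs ?subr_ge0// [RHS]addrC subrK.
  elim: `|m - n|%N => [|i IH]; first by rewrite addr0 fn.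
  rewrite -addn1 PoszD addrA; apply: (fR _ _ IH).1.
  by rewrite lerDl.
exists f; split=> // [m mn|m nm].
  rewrite /f; case: pselect => // nm.
  by exfalso; move: mn; rewrite ltNge nm.
by split; [exact: fG | exact: (fR _ nm (fG _ nm)).2].
Qed.

(** * Preadditive categories with kernels and biproducts *)

Section Preadditive.
Variable C : preadditive.
Implicit Types A B D P X Y Z : C.

Lemma compBl A B D (g g' : mor B D) (f : mor A B) :
  (g - g') \oc f = g \oc f - g' \oc f.
Proof. by rewrite compDl compNm. Qed.

Lemma compBr A B D (g : mor B D) (f f' : mor A B) :
  g \oc (f - f') = g \oc f - g \oc f'.
Proof. by rewrite compDr compmN. Qed.

Lemma mono0 A B (f : mor A B) Z (g : mor Z A) : mono f -> f \oc g = 0 -> g = 0.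
Proof. by move=> fm fg; apply: fm; rewrite fg compm0. Qed.

Lemma epi0 A B (f : mor A B) Z (g : mor B Z) : epi f -> g \oc f = 0 -> g = 0.
Proof. by move=> fe gf; apply: fe; rewrite gf comp0m. Qed.

Lemma epiP A B (f : mor A B) :
  (forall Z (g : mor B Z), g \oc f = 0 -> g = 0) -> epi f.
Proof.
move=> h Z g g' E; apply: subr0_eq; apply: h; by rewrite compBl E subrr.
Qed.

Lemma monoP A B (f : mor A B) :
  (forall Z (g : mor Z A), f \oc g = 0 -> g = 0) -> mono f.
Proof.
move=> h Z g g' E; apply: subr0_eq; apply: h; by rewrite compBr E subrr.
Qed.

Lemma section_epi A B (f : mor A B) (s : mor B A) : f \oc s = idm B -> epi f.
Proof. by move=> fs Z g g' E; rewrite -[g]compm1 -[g']compm1 -fs !compA E. Qed.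

Lemma retraction_mono A B (f : mor A B) (r : mor B A) : r \oc f = idm A ->
    mono f.
Proof. by move=> rf Z g g' E; rewrite -[g]comp1m -[g']comp1m -rf -!compA E. Qed.

Lemma kernel_mono A B K (f : mor A B) (k : mor K A) : is_kernel f k -> mono k.
Proof.
move=> [fk ku] Z g g' E.
have [|h [_ hu]] := ku _ (k \oc g); first by rewrite compA fk comp0m.
by rewrite -(hu g)// (hu g').
Qed.

Lemma kernel_lift A B K (f : mor A B) (k : mor K A) : is_kernel f k ->
  forall Z (g : mor Z A), f \oc g = 0 -> exists g' : mor Z K, k \oc g' = g.
Proof. by move=> [_ ku] Z g /ku[g' [? _]]; exists g'. Qed.

Lemma is_kernelP A B K (f : mor A B) (k : mor K A) : f \oc k = 0 -> mono k ->
  (forall Z (g : mor Z A), f \oc g = 0 -> exists g' : mor Z K, k \oc g' = g) ->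
  is_kernel f k.
Proof.
move=> fk km kl; split=> // Z g /kl[g' E]; exists g'; split=> // h Eh.
by apply: km; rewrite E Eh.
Qed.

Lemma cokernel_epi A B Q (f : mor A B) (q : mor B Q) : is_cokernel f q -> epi q.
Proof.
move=> [qf qu] Z g g' E.
have [|h [_ hu]] := qu _ (g \oc q); first by rewrite -compA qf compm0.
by rewrite -(hu g)// (hu g').
Qed.

Lemma cokernel_desc A B Q (f : mor A B) (q : mor B Q) : is_cokernel f q ->
  forall Z (g : mor B Z), g \oc f = 0 -> exists g' : mor Q Z, g' \oc q = g.
Proof. by move=> [_ qu] Z g /qu[g' [? _]]; exists g'. Qed.

Lemma is_cokernelP A B Q (f : mor A B) (q : mor B Q) : q \oc f = 0 -> epi q ->
  (forall Z (g : mor B Z), g \oc f = 0 -> exists g' : mor Q Z, g' \oc q = g) ->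
  is_cokernel f q.
Proof.
move=> fk km kl; split=> // Z g /kl[g' E]; exists g'; split=> // h Eh.
by apply: km; rewrite E Eh.
Qed.

Lemma retract_projective P Q (i : mor P Q) (r : mor Q P) :
  r \oc i = idm P -> projective Q -> projective P.
Proof.
move=> ri Qp A B e ee f; have [g eg] := Qp _ _ e ee (f \oc r).
by exists (g \oc i); rewrite compA eg -compA ri compm1.
Qed.

Definition has_kernels := forall A B (f : mor A B),
  exists K (k : mor K A), is_kernel f k.

Definition has_biproducts := forall A B,
  exists S (iA : mor A S) (iB : mor B S) (pA : mor S A) (pB : mor S B),
    is_biproduct iA iB pA pB.

Definition zero_object Z := idm Z = 0.

Lemma to_zero_object Z A (f : mor A Z) : zero_object Z -> f = 0.
Proof. by move=> z; rewrite -[f]comp1m z comp0m. Qed.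

Lemma from_zero_object Z A (f : mor Z A) : zero_object Z -> f = 0.
Proof. by move=> z; rewrite -[f]compm1 z compm0. Qed.

Lemma zero_object_exists A : has_kernels -> exists Z, zero_object Z.
Proof.
move=> /(_ _ _ (idm A))[Z [k kk]]; exists Z.
by apply: (kernel_mono kk); rewrite compm1 compm0 -[k]comp1m kk.1.
Qed.

(** With kernels idempotents split, so every retract has a complement. *)
Lemma retract_summand A S (i : mor A S) (r : mor S A) :
  has_kernels -> r \oc i = idm A -> direct_summand A S.
Proof.
move=> /(_ _ _ r)[B [k kk]] ri.
have [|p kp] := kernel_lift kk (g := idm S - i \oc r).
  by rewrite compBr compm1 compA ri comp1m subrr.
exists B, i, k, r, p; split=> //.
- by apply: (kernel_mono kk); rewrite compA kp compBl comp1m -compA kk.1 compm0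
    subr0 compm1.
- exact: kk.1.
- by apply: (kernel_mono kk); rewrite compA kp compBl comp1m -compA ri compm1
    subrr compm0.
- by rewrite kp addrC subrK.
Qed.

End Preadditive.

(** * Chain complexes *)

Section Chains.
Variable C : preadditive.
Implicit Types X Y Z W : Ch C.

Lemma ch_ext X Y (f g : mor X Y) : (forall n, at_deg f n = at_deg g n) -> f = g.
Proof. exact: chain_map_ext. Qed.

Lemma at_degM X Y Z (g : mor Y Z) (f : mor X Y) n :
  at_deg (g \oc f) n = at_deg g n \oc at_deg f n.
Proof. by []. Qed.

Lemma at_degD X Y (f g : mor X Y) n : at_deg (f + g) n =
    at_deg f n + at_deg g n.
Proof. by []. Qed.

Lemma at_degN X Y (f : mor X Y) n : at_deg (- f) n = - at_deg f n.
Proof. by []. Qed.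

Lemma at_deg0 X Y n : at_deg (0 : mor X Y) n = 0.
Proof. by []. Qed.

Lemma at_deg1 X n : at_deg (idm X) n = idm (X n).
Proof. by []. Qed.

Lemma at_deg_bdry X Y (f : mor X Y) n :
  at_deg f n \oc bdry X n = bdry Y n \oc at_deg f (n + 1).
Proof. exact: (cmapP (f : chain_map X Y) n). Qed.

Lemma ch_mor X Y (f : forall n, mor (X n) (Y n)) :
  (forall n, f n \oc bdry X n = bdry Y n \oc f (n + 1)) ->
  exists F : mor X Y, forall n, at_deg F n = f n.
Proof. by move=> fP; exists (ChainMap fP). Qed.

Lemma termwise_epi X Y (f : mor X Y) : (forall n, epi (at_deg f n)) -> epi f.
Proof.
by move=> fe Z g h E; apply: ch_ext => n; apply: fe; rewrite -!at_degM E.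
Qed.

Lemma termwise_mono X Y (f : mor X Y) : (forall n, mono (at_deg f n)) -> mono f.
Proof.
by move=> fe Z g h E; apply: ch_ext => n; apply: fe; rewrite -!at_degM E.
Qed.

(** The cycles of degree -1 in the Hom complex. As off-diagonal entries of
    boundaries they describe the termwise split extensions of [X] by [Y]. With
    boundaries indexed by their target this degree needs no change of
    indices. *)
Definition cocycle X Y (t : forall n, mor (X (n + 1)) (Y n)) :=
  forall n, bdry Y n \oc t (n + 1) + t n \oc bdry X (n + 1) = 0.

(** Such an entry can be removed by a change of splitting [s]. *)
Definition coboundary X Y (t : forall n, mor (X (n + 1)) (Y n))
    (s : forall n, mor (X n) (Y n)) :=
  forall n, t n = bdry Y n \oc s (n + 1) - s n \oc bdry X n.

Lemma cocycle_anti X Y (t : forall n, mor (X (n + 1)) (Y n)) n : cocycle t ->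
  t n \oc bdry X (n + 1) = - (bdry Y n \oc t (n + 1)).
Proof. by move=> tc; apply: (addrI (bdry Y n \oc t (n + 1)));
  rewrite tc subrr. Qed.

Lemma cocycle_comp X Y Z (f : mor Y Z) (t : forall n, mor (X (n + 1)) (Y n)) :
  cocycle t -> cocycle (X := X) (Y := Z) (fun n => at_deg f n \oc t n).
Proof.
by move=> tc n; rewrite compA -at_deg_bdry -!compA -compDr tc compm0.
Qed.

Lemma cocycle_cancel X Y Z (f : mor Y Z) (t : forall n, mor (X (n + 1)) (Y n)) :
  (forall n, mono (at_deg f n)) ->
  cocycle (X := X) (Y := Z) (fun n => at_deg f n \oc t n) -> cocycle t.
Proof.
move=> fm tc n; apply: (mono0 (fm n)).
by have := tc n; rewrite compDr !compA at_deg_bdry.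
Qed.

Lemma coboundary_comp X Y Z (f : mor Y Z) (t : forall n, mor (X (n + 1)) (Y n))
    s :
  coboundary t s -> coboundary (X := X) (Y := Z)
    (fun n => at_deg f n \oc t n) (fun n => at_deg f n \oc s n).
Proof. by move=> ts n; rewrite ts compBr !compA at_deg_bdry. Qed.

Lemma coboundary_cancel X Y Z (f : mor Y Z)
    (t : forall n, mor (X (n + 1)) (Y n)) s :
  (forall n, mono (at_deg f n)) ->
  coboundary (X := X) (Y := Z)
    (fun n => at_deg f n \oc t n) (fun n => at_deg f n \oc s n) ->
  coboundary t s.
Proof.
by move=> fm ts n; apply: fm; rewrite ts compBr !compA at_deg_bdry.
Qed.

(** The failure of a termwise map to commute with the boundaries. *)
Lemma defect_cocycle X Y (l : forall n, mor (X n) (Y n)) :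
  cocycle (X := X) (Y := Y)
    (fun n => bdry Y n \oc l (n + 1) - l n \oc bdry X n).
Proof.
move=> n; rewrite compBr compBl !compA diffK comp0m -[l n \oc _ \oc _]compA
  diffK.
by rewrite compm0 subr0 sub0r addNr.
Qed.

(** *** Kernels *)

Lemma ch_kernel X Y (f : mor X Y) : has_kernels C ->
  exists K (k : mor K X), forall n, is_kernel (at_deg f n) (at_deg k n).
Proof.
move=> hk; have [K /dependent_choice[k kk]] :=
  dependent_choice (fun n => hk _ _ (at_deg f n)).
have /dependent_choice[d dE] n : exists d : mor (K (n + 1)) (K n),
    k n \oc d = bdry X n \oc k (n + 1).
  apply: (kernel_lift (kk n)).
  by rewrite compA at_deg_bdry -compA (kk (n + 1)).1 compm0.
have dK n : d n \oc d (n + 1) = 0.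
  apply: (mono0 (kernel_mono (kk n))).
  by rewrite compA dE -compA dE compA diffK comp0m.
have [F FE] := @ch_mor (Chain dK) X k dE.
by exists (Chain dK), F => n; rewrite FE.
Qed.

Lemma termwise_is_kernel X Y K (f : mor X Y) (k : mor K X) :
  (forall n, is_kernel (at_deg f n) (at_deg k n)) -> is_kernel f k.
Proof.
move=> kk; have km n := kernel_mono (kk n); apply: is_kernelP.
- by apply: ch_ext => n; exact: (kk n).1.
- exact: termwise_mono.
move=> Z g fg.
have /dependent_choice[h hE] n : exists h, at_deg k n \oc h = at_deg g n.
  by apply: (kernel_lift (kk n)); rewrite -at_degM fg.
have [|F FE] := @ch_mor Z K h.
  by move=> n; apply: km; rewrite !compA hE !at_deg_bdry -!compA hE.
by exists F; apply: ch_ext => n; rewrite at_degM FE hE.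
Qed.

(** Any kernel is isomorphic to the one that is formed termwise. *)
Lemma is_kernel_termwise X Y K (f : mor X Y) (k : mor K X) : has_kernels C ->
  is_kernel f k -> forall n, is_kernel (at_deg f n) (at_deg k n).
Proof.
move=> hk kk n; have [K' [k' kk']] := ch_kernel f hk.
have kk'' := termwise_is_kernel kk'.
have [u uE] := kernel_lift kk kk''.1; have [v vE] := kernel_lift kk'' kk.1.
have uv : u \oc v = idm K.
  by apply: (kernel_mono kk); rewrite compA uE vE compm1.
apply: is_kernelP; first by rewrite -at_degM kk.1.
  apply: monoP => Z g; rewrite -vE at_degM -compA => h.
  have := mono0 (kernel_mono (kk' n)) h => {}h.
  by rewrite -[g]comp1m -at_deg1 -uv at_degM -compA h compm0.
move=> Z g /(kernel_lift (kk' n))[h hE]; exists (at_deg u n \oc h).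
by rewrite compA -at_degM uE.
Qed.

Lemma mono_termwise X Y (f : mor X Y) : has_kernels C ->
  mono f -> forall n, mono (at_deg f n).
Proof.
move=> hk fm n; have [K [k kk]] := ch_kernel f hk; apply: monoP => Z g.
move=> /(kernel_lift (kk n))[h <-].
suff -> : k = 0 by rewrite at_deg0 comp0m.
by apply: (mono0 fm); have [->] := termwise_is_kernel kk.
Qed.

(** *** Cokernels of termwise split monomorphisms *)

Section SplitCokernel.
Variables (V W : Ch C) (i : mor V W) (r : forall n, mor (W n) (V n)).
Hypotheses (hk : has_kernels C) (ri : forall n, r n \oc at_deg i n = idm (V n)).

(** The cokernel is formed as the kernel of the retractions, so that it exists
    as soon as kernels do. The retractions are not a chain map; still the
    boundary of [W] induces one on their kernels, through the projections
    [q]. *)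
Lemma split_cokernel_exists :
  exists Q (q : mor W Q) (s : forall n, mor (Q n) (W n)), is_cokernel i q /\
    forall n, [/\ at_deg q n \oc s n = idm (Q n), r n \oc s n = 0
      & at_deg i n \oc r n + s n \oc at_deg q n = idm (W n)].
Proof.
have [Q /dependent_choice[s sk]] := dependent_choice (fun n => hk (r n)).
have sm n := kernel_mono (sk n).
have /dependent_choice[q qE] n : exists q : mor (W n) (Q n),
    s n \oc q = idm (W n) - at_deg i n \oc r n.
  by apply: (kernel_lift (sk n)); rewrite compBr compm1 compA ri comp1m subrr.
have qi n : q n \oc at_deg i n = 0.
  by apply: (mono0 (sm n)); rewrite compA qE compBl comp1m -compA ri compm1
    subrr.
have qs n : q n \oc s n = idm (Q n).
  by apply: (sm n); rewrite compA qE compBl -compA (sk n).1 compm0 subr0 comp1m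
    compm1.
pose d n := q n \oc bdry W n \oc s (n + 1).
have dq n : q n \oc bdry W n = d n \oc q (n + 1).
  rewrite /d -[RHS]compA qE compBr compm1 !compA -[_ \oc _ \oc at_deg i _]compA.
  by rewrite -at_deg_bdry !compA qi !comp0m subr0.
have dK n : d n \oc d (n + 1) = 0.
  by rewrite [d (n + 1)]/d !compA -dq -[q n \oc _ \oc _]compA diffK compm0
    comp0m.
have [F FE] := @ch_mor W (Chain dK) q dq.
have Fs n : at_deg F n \oc s n = idm _ by rewrite FE qs.
exists (Chain dK), F, s; split=> [|n]; last first.
  by split=> //; [exact: (sk n).1 | rewrite FE qE addrC subrK].
apply: is_cokernelP.
- by apply: ch_ext => n; rewrite at_degM FE qi.
- by apply: termwise_epi => n; exact: (section_epi (Fs n)).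
move=> Z g gi.
have gE n : at_deg g n \oc s n \oc q n = at_deg g n.
  by rewrite -compA qE compBr compA -at_degM gi comp0m subr0 compm1.
have [|G GE] := @ch_mor (Chain dK) Z (fun n => at_deg g n \oc s n).
  by move=> n; rewrite /= /d !compA gE at_deg_bdry.
by exists G; apply: ch_ext => n; rewrite at_degM GE FE gE.
Qed.

Lemma split_cokernel Q (q : mor W Q) : is_cokernel i q ->
  exists s : forall n, mor (Q n) (W n),
    forall n, [/\ at_deg q n \oc s n = idm (Q n), r n \oc s n = 0
      & at_deg i n \oc r n + s n \oc at_deg q n = idm (W n)].
Proof.
move=> qc; have [Q' [q' [s [qc' sP]]]] := split_cokernel_exists.
have [a aE] := cokernel_desc qc qc'.1; have [b bE] := cokernel_desc qc' qc.1.
have ba : b \oc a = idm Q.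
  by apply: (cokernel_epi qc); rewrite -compA aE bE comp1m.
exists (fun n => s n \oc at_deg a n) => n; have [qs rs irs] := sP n; split.
- by rewrite -bE at_degM compA -[at_deg b n \oc _ \oc _]compA qs compm1 -at_degM
  ba.
- by rewrite compA rs comp0m.
- by rewrite -compA -at_degM aE.
Qed.

End SplitCokernel.

(** *** Termwise split extensions *)

Lemma twisted_extension X Y (t : forall n, mor (X (n + 1)) (Y n)) :
  has_biproducts C -> cocycle t ->
  exists E (j : mor Y E) (q : mor E X)
      (p : forall n, mor (E n) (Y n)) (s : forall n, mor (X n) (E n)),
    (forall n, is_biproduct (at_deg j n) (s n) (p n) (at_deg q n)) /\
    forall n, bdry E n \oc s (n + 1) = at_deg j n \oc t n + s n \oc bdry X n.
Proof.
move=> hb tc.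
have [E /dependent_choice[j /dependent_choice[s
  /dependent_choice[p /dependent_choice[q E_]]]]] :=
  dependent_choice (fun n => hb (Y n) (X n)).
pose d n : mor (E (n + 1)) (E n) :=
  j n \oc bdry Y n \oc p (n + 1) + j n \oc t n \oc q (n + 1)
  + s n \oc bdry X n \oc q (n + 1).
have dj n : d n \oc j (n + 1) = j n \oc bdry Y n.
  rewrite /d; case: (E_ (n + 1)) => pj _ _ qj _.
  by rewrite !compDl -!compA pj qj !compm0 !addr0 compm1.
have ds n : d n \oc s (n + 1) = j n \oc t n + s n \oc bdry X n.
  rewrite /d; case: (E_ (n + 1)) => _ qs ps _ _.
  by rewrite !compDl -!compA ps qs !compm0 !compm1 add0r.
have qd n : q n \oc d n = bdry X n \oc q (n + 1).
  rewrite /d; case: (E_ n) => _ qs _ qj _.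
  by rewrite !compDr !compA qj qs !comp0m !add0r comp1m.
have dK n : d n \oc d (n + 1) = 0.
  case: (E_ (n + 1 + 1)) => _ _ _ _ one.
  rewrite -[_ \oc _]compm1 -one compDr !compA -[_ \oc j _]compA dj.
  rewrite compA dj -[j n \oc _ \oc _]compA diffK compm0 comp0m add0r.
  rewrite -[_ \oc s _]compA ds compDr !compA dj ds compDl.
  rewrite -compDl [(_ + _) \oc bdry _ _]compDl -[s n \oc _ \oc _]compA diffK
    compm0 addr0.
  by rewrite -[j n \oc _ \oc _]compA -[j n \oc t n \oc _]compA -compDr tc compm0
    comp0m.
have [J JE] := @ch_mor Y (Chain dK) j (fun n => esym (dj n)).
have [Q QE] := @ch_mor (Chain dK) X q qd.
exists (Chain dK), J, Q, p, s; split=> n; rewrite JE ?QE; first exact: E_.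
exact: ds.
Qed.

(** A section of a termwise split extension differs from the chosen splitting by
    a map to the subobject that cobounds the off-diagonal entry. *)
Lemma section_coboundary X Y E (t : forall n, mor (X (n + 1)) (Y n))
    (j : mor Y E) (q : mor E X) (p : forall n, mor (E n) (Y n))
    (s : forall n, mor (X n) (E n)) (u : mor X E) :
  (forall n, is_biproduct (at_deg j n) (s n) (p n) (at_deg q n)) ->
  (forall n, bdry E n \oc s (n + 1) = at_deg j n \oc t n + s n \oc bdry X n) ->
  q \oc u = idm X -> exists s', coboundary t s'.
Proof.
move=> EP ds qu; pose a m := p m \oc at_deg u m.
have uE n : at_deg u n = at_deg j n \oc a n + s n.
  have [_ _ _ _ one] := EP n.
  by rewrite -[LHS]comp1m -one compDl -!compA -at_degM qu at_deg1 compm1.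
exists (fun n => - a n) => n.
have E1 : at_deg j n \oc a n \oc bdry X n
    = at_deg j n \oc bdry Y n \oc a (n + 1) + at_deg j n \oc t n.
  apply: (addIr (s n \oc bdry X n)); rewrite -[RHS]addrA -ds at_deg_bdry.
  by rewrite -[bdry E n \oc _ \oc _]compA -compDr -compDl -!uE at_deg_bdry.
have [pj _ _ _ _] := EP n; apply: (retraction_mono pj).
rewrite -[LHS](addKr (at_deg j n \oc bdry Y n \oc a (n + 1))) -E1.
by rewrite compmN compNm opprK compDr compmN !compA.
Qed.

End Chains.

(** * Disks *)

Section Disks.
Variable C : preadditive.
Implicit Types (X E F : Ch C) (A B : int -> C).

(** The complex with terms [A n (+) A (n - 1)] and boundary [(a, b) |-> (b, 0)]:
    the sum of the disks on the [A n]. The summand [A (n - 1)] is not mentioned: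
    in degree [n + 1] it is embedded by [s n], with projection
    [p n \oc bdry E n]. *)
Definition is_disk A E (p : forall n, mor (E n) (A n))
    (j : forall n, mor (A n) (E n)) (s : forall n, mor (A n) (E (n + 1))) :=
  forall n, [/\ p n \oc j n = idm (A n), bdry E n \oc s n = j n,
      p (n + 1) \oc s n = 0
    & j (n + 1) \oc p (n + 1) + s n \oc (p n \oc bdry E n) = idm (E (n + 1))].

Lemma disk_exists A : has_biproducts C -> exists E p j s, @is_disk A E p j s.
Proof.
move=> hb.
(* [B n] is [A (n - 1)], identified with it by [a] and [b]. *)
have [B BA] : exists B : int -> C, forall n, exists a : mor (B (n + 1)) (A n),
    exists b : mor (A n) (B (n + 1)), a \oc b = idm _ /\ b \oc a = idm _.
  have [B BE] := reindex_succ (T := fun=> C) A.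
  by exists B => n; rewrite BE; exists (idm _), (idm _); rewrite comp1m.
have [a /dependent_choice[b ab]] := dependent_choice BA.
have [E /dependent_choice[i1 /dependent_choice[i2
  /dependent_choice[p1 /dependent_choice[p2 EP]]]]] :=
  dependent_choice (fun n => hb (A n) (B n)).
pose d n := i1 n \oc a n \oc p2 (n + 1).
have dK n : d n \oc d (n + 1) = 0.
  rewrite /d !compA -[_ \oc p2 _ \oc i1 _]compA; case: (EP (n + 1)) => _ _ _ ->
    _.
  by rewrite compm0 !comp0m.
exists (Chain dK), p1, i1, (fun n => i2 (n + 1) \oc b n) => n /=.
have [p1i1 _ p1i2 _ _] := EP n; have [_ p2i2' p1i2' _ one'] := EP (n + 1).
have [a_b b_a] := ab n; split=> //.
- by rewrite /d -[_ \oc p2 _ \oc _]compA [p2 _ \oc _]compA p2i2' comp1m -compA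
  a_b
    compm1.
- by rewrite compA p1i2' comp0m.
- rewrite -[RHS]one'; congr (_ + _).
  by rewrite /d !compA -[_ \oc p1 n \oc i1 n]compA p1i1 compm1
    -[_ \oc b n \oc _]compA
    b_a compm1.
Qed.

Section Maps.
Variables (A : int -> C) (E : Ch C).
Variables (p : forall n, mor (E n) (A n)).
Variables (j : forall n, mor (A n) (E n)) (s : forall n, mor (A n) (E (n + 1))).
Hypothesis Ed : is_disk p j s.

Lemma disk_split X n (f : mor X E) :
  at_deg f (n + 1) = j (n + 1) \oc (p (n + 1) \oc at_deg f (n + 1))
    + s n \oc (p n \oc at_deg f n) \oc bdry X n.
Proof.
have [_ _ _ one] := Ed n.
rewrite -[LHS]comp1m -one compDl !compA; congr (_ + _).
by rewrite -[LHS]compA -at_deg_bdry !compA.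
Qed.

(** Chain maps to a disk are the same as families of maps to the [A n], because
    the components in the other summands are forced by the boundaries. *)
Lemma disk_map_inj X (f g : mor X E) :
  (forall n, p n \oc at_deg f n = p n \oc at_deg g n) -> f = g.
Proof.
move=> fg; apply: ch_ext; apply: int_succ_ind => n.
by rewrite disk_split [RHS]disk_split !fg.
Qed.

Lemma disk_map_exists X (u : forall n, mor (X n) (A n)) :
  exists f : mor X E, forall n, p n \oc at_deg f n = u n.
Proof.
have [f fE] := reindex_succ (T := fun n => mor (X n) (E n))
  (fun n => j (n + 1) \oc u (n + 1) + s n \oc u n \oc bdry X n).
have djz n : bdry E n \oc j (n + 1) = 0.
  by have [_ <- _ _] := Ed (n + 1); rewrite compA diffK comp0m.
have [|F FE] := @ch_mor _ X E f.
  apply: int_succ_ind => n; rewrite !fE compDl compDr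
    -[_ \oc bdry X n \oc _]compA.
  rewrite diffK compm0 addr0 !compA djz comp0m add0r.
  by have [_ -> _ _] := Ed (n + 1).
exists F; apply: int_succ_ind => n; rewrite FE fE compDr !compA.
have [_ _ -> _] := Ed n; have [-> _ _ _] := Ed (n + 1).
by rewrite comp1m !comp0m addr0.
Qed.

(** This contraction turns every cocycle with values in a disk into a
    coboundary. *)
Lemma disk_contraction n :
  bdry E (n + 1) \oc (s (n + 1) \oc p (n + 1)) + s n \oc p n \oc bdry E n
  = idm (E (n + 1)).
Proof.
have [_ _ _ one] := Ed n; have [_ ds _ _] := Ed (n + 1).
by rewrite compA ds -compA.
Qed.

End Maps.

Section Morphism.
Variables (A B : int -> C) (E F : Ch C).
Variables (p : forall n, mor (E n) (A n)) (p' : forall n, mor (F n) (B n)).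
Variables (j : forall n, mor (A n) (E n)) (s : forall n, mor (A n) (E (n + 1))).
Variables (j' : forall n, mor (B n) (F n))
  (s' : forall n, mor (B n) (F (n + 1))).
Hypotheses (Ed : is_disk p j s) (Fd : is_disk p' j' s').
Variables (g : forall n, mor (A n) (B n)) (f : mor E F).
Hypothesis fg : forall n, p' n \oc at_deg f n = g n \oc p n.

Lemma disk_morph_s n : at_deg f (n + 1) \oc s n = s' n \oc g n.
Proof.
have [pj ds ps _] := Ed n; rewrite (disk_split Fd) !fg compDl.
rewrite -[_ \oc s n]compA -[_ \oc p _ \oc s n]compA ps !compm0 add0r.
by rewrite -[_ \oc s n]compA ds -!compA pj compm1.
Qed.

Lemma disk_morph_j n : at_deg f n \oc j n = j' n \oc g n.
Proof.
have [_ <- _ _] := Ed n; have [_ <- _ _] := Fd n.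
by rewrite compA at_deg_bdry -[LHS]compA disk_morph_s compA.
Qed.

Lemma disk_morph_contraction n :
  at_deg f (n + 1) \oc (s n \oc p n) = s' n \oc p' n \oc at_deg f n.
Proof. by rewrite compA disk_morph_s -!compA fg. Qed.

(** Stated for the image of [f] under an additive functor, as the disk on a map
    that becomes epi only after applying the functor is what is needed. *)
Lemma disk_morph_epi (D : preadditive) (U : additive_functor C D) :
  (forall n, epi (fmap U (g n))) -> forall n, epi (fmap U (at_deg f n)).
Proof.
move=> ge; apply: int_succ_ind => n; apply: epiP => Z w wf.
have ws : w \oc fmap U (s' n) = 0.
  apply: (epi0 (ge n)).
  by rewrite -compA -fmapM -disk_morph_s fmapM compA wf comp0m.
have wj : w \oc fmap U (j' (n + 1)) = 0.
  apply: (epi0 (ge (n + 1))).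
  by rewrite -compA -fmapM -disk_morph_j fmapM compA wf comp0m.
have [_ _ _ one] := Fd n.
rewrite -[w]compm1 -fmap1 -one fmapD !fmapM compDr !compA wj ws.
by rewrite !comp0m addr0.
Qed.

End Morphism.

(** A map [w] that vanishes on [f] in one degree, extended by zero to the other
    degrees, is a chain map to a disk that vanishes on [f]. *)
Lemma epi_termwise (X Y : Ch C) (f : mor X Y) : has_biproducts C ->
  epi f -> forall n, epi (at_deg f n).
Proof.
move=> hb fe n; apply: epiP => Z w wf.
have [E [p [j [s Ed]]]] := disk_exists (fun=> Z) hb.
have [u uE] : exists u : forall m, mor (Y m) Z,
    u n = w /\ forall m, u m \oc at_deg f m = 0.
  exists (fun m => match n =P m with
    | ReflectT e => transport (T := fun m => mor (Y m) Z) e w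
    | ReflectF _ => 0 end).
  split=> [|m]; first by case: eqP => // e; rewrite (eq_axiomK e).
  case: eqP => [e|_]; last by rewrite comp0m.
  by case: m / e.
have [F FE] := disk_map_exists Ed u.
suff F0 : F = 0 by rewrite -uE.1 -FE F0 at_deg0 compm0.
apply: (epi0 fe); apply: (disk_map_inj Ed) => m.
by rewrite at_degM compA FE uE.2 at_deg0 compm0.
Qed.

End Disks.

(** * Trivial fibrations of the singular projective model structure *)

Definition normal (C : preadditive) := forall (A B : C) (f : mor A B), mono f ->
  exists (J : C) (h : mor B J), is_kernel h f.

(** A monomorphism [j] of complexes is the kernel of its cokernel. The cokernel
    need not be known explicitly: a family of maps with kernels the [j n] is a
    single chain map to a disk, and that map factors through the cokernel. *)
Lemma mono_kernel_cokernel (C : preadditive) (A E Q : Ch C)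
    (j : mor A E) (c : mor E Q) :
  has_kernels C -> has_biproducts C -> normal C -> mono j -> is_cokernel j c ->
  forall n, is_kernel (at_deg c n) (at_deg j n).
Proof.
move=> hk hb hN jm jc n; have jmn := mono_termwise hk jm.
have [J /dependent_choice[h hP]] :=
  dependent_choice (fun m => hN _ _ (at_deg j m) (jmn m)).
have [F [p [i [s Fd]]]] := disk_exists J hb.
have [H HE] := disk_map_exists Fd h.
have [|w wE] := cokernel_desc jc (g := H).
  apply: (disk_map_inj Fd) => m.
  by rewrite at_degM compA HE (hP m).1 compm0.
apply: is_kernelP => // [|Z g cg]; first by rewrite -at_degM jc.1.
apply: (kernel_lift (hP n)).
by rewrite -HE -wE at_degM -!compA cg !compm0.
Qed.

Section TrivialFibrations.
Variable R : pzRingType.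
Hypotheses (hk : has_kernels (Mod R)) (hb : has_biproducts (Mod R)).
Hypothesis hN : normal (Mod R).
Implicit Types X Y : Ch (Mod R).

(** The cocycles [t] with [f \oc t = 0] are those with values in the kernel of
    [f]. So this says that [f] is a termwise epimorphism and that its kernel has
    only split extensions by acyclic complexes of projectives as quotients. *)
Definition trivial_fibration X Y (f : mor X Y) :=
  (forall n, epi (at_deg f n)) /\
  forall (P : Ch (Mod R)) (t : forall n, mor (P (n + 1)) (X n)),
    acyclic_projective P -> cocycle t -> (forall n, at_deg f n \oc t n = 0) ->
    exists s : forall n, mor (P n) (X n),
      coboundary t s /\ forall n, at_deg f n \oc s n = 0.

(** The extension with off-diagonal entry [t] splits. *)
Lemma sp_trivial_coboundary (P K : Ch (Mod R))
    (t : forall n, mor (P (n + 1)) (K n)) :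
  acyclic_projective P -> sp_trivial K -> cocycle t ->
  exists s, coboundary t s.
Proof.
move=> PP Kt tc; have [E [j [q [p [s [EP ds]]]]]] := twisted_extension hb tc.
have jK : forall n, is_kernel (at_deg q n) (at_deg j n).
  move=> n; have [pj qs ps qj one] := EP n.
  apply: is_kernelP => // [|Z g qg]; first exact: retraction_mono pj.
  exists (p n \oc g).
  by rewrite compA -[RHS]comp1m -one compDl -[s n \oc _ \oc _]compA qg compm0
    addr0.
have qC : is_cokernel j q.
  apply: is_cokernelP.
  - by apply: ch_ext => n; rewrite at_degM; have [_ _ _ -> _] := EP n.
  - by apply: termwise_epi => n; have [_ qs _ _ _] := EP n;
    exact: section_epi qs.
  move=> Z g gj.
  have gE n : at_deg g n \oc s n \oc at_deg q n = at_deg g n.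
    have [_ _ _ _ one] := EP n.
    by rewrite -[RHS]compm1 -one compDr !compA -at_degM gj comp0m add0r.
  have [|G GE] := @ch_mor _ P Z (fun n => at_deg g n \oc s n).
    move=> n; rewrite -compA -[s n \oc _](addKr (at_deg j n \oc t n)) -ds.
    by rewrite compDr compmN compA -at_degM gj comp0m oppr0 add0r compA
      at_deg_bdry compA.
  by exists G; apply: ch_ext => n; rewrite at_degM GE gE.
have [|u qu] := Kt P PP E j q; first by split=> //; exact: termwise_is_kernel.
exact: section_coboundary EP ds qu.
Qed.

(** The extension splits termwise because [X] consists of projectives, and the
    failure of these splittings to form a chain map is a cocycle. *)
Lemma coboundary_ext1_zero (X K : Ch (Mod R)) : (forall n, projective (X n)) ->
  (forall t : forall n, mor (X (n + 1)) (K n), cocycle t ->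
    exists s, coboundary t s) ->
  Ext1_zero X K.
Proof.
move=> Xp tK E j q [jk qc]; have jkn := is_kernel_termwise hk jk.
have jm n := kernel_mono (jkn n).
have qe := epi_termwise hb (cokernel_epi qc).
have /dependent_choice[s qs] n : exists s, at_deg q n \oc s = idm (X n).
  exact: Xp.
have /dependent_choice[t tE] n : exists t : mor (X (n + 1)) (K n),
    at_deg j n \oc t = bdry E n \oc s (n + 1) - s n \oc bdry X n.
  apply: (kernel_lift (jkn n)).
  by rewrite compBr !compA at_deg_bdry qs -[bdry X n \oc _ \oc _]compA qs
    compm1 comp1m subrr.
have tc : cocycle t.
  apply: (cocycle_cancel jm) => n.
  by have := defect_cocycle (X := X) (Y := E) s n; rewrite -!tE.
have [a aE] := tK t tc.
have [|u uE] := @ch_mor _ X E (fun n => s n - at_deg j n \oc a n).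
  move=> n; have := tE n; rewrite aE compBr !compA at_deg_bdry => E1.
  rewrite compBl compBr -[bdry E n \oc s _](subrK (s n \oc bdry X n)) -E1
    !compA.
  by rewrite [RHS]addrAC [X in _ = X + _]addrAC subrr add0r; exact: addrC.
exists u; apply: ch_ext => n.
by rewrite at_degM uE compBr qs compA -at_degM jk.1 comp0m subr0.
Qed.

Lemma trivial_fibration_weq X Y (f : mor X Y) : trivial_fibration f ->
  fib (singular_projective R) f /\ weq (singular_projective R) f.
Proof.
move=> [fe fP]; have f_epi := termwise_epi fe; split=> //.
have hkC : has_kernels (Ch (Mod R)).
  move=> A B g; have [K [k kk]] := ch_kernel g hk.
  by exists K, k; exact: termwise_is_kernel.
exists X, (idm X), f; split=> //; first by rewrite compm1.
- by move=> Z g h; rewrite !comp1m.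
- have [Z Z0] := zero_object_exists X hkC.
  exists Z, 0; split.
    apply: is_cokernelP; first by rewrite comp0m.
      by apply: epiP => D g _; exact: from_zero_object.
    by move=> D g; rewrite compm1 => ->; exists 0; rewrite compm0.
  by move=> A B e _ g; exists 0; rewrite compm0 [RHS]from_zero_object.
have [K [k kk]] := ch_kernel f hk; exists K, k; split.
  exact: termwise_is_kernel.
move=> P PP; apply: coboundary_ext1_zero => [|t tc]; first by case: PP.
have km n := kernel_mono (kk n).
have [||s [ts fs]] := fP P (fun n => at_deg k n \oc t n) PP.
- exact: cocycle_comp.
- by move=> n; rewrite compA (kk n).1 comp0m.
have /dependent_choice[s' sE] n : exists s', at_deg k n \oc s' = s n.
  exact: (kernel_lift (kk n)).
exists s'; apply: (coboundary_cancel km) => n; rewrite !sE.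
exact: ts.
Qed.

(** A weak equivalence is a monomorphism [j] with projective cokernel [Q]
    followed by an epimorphism [q] with trivial kernel. When the composite is
    epi, [Q] lifts into the kernel of [q], so that the kernel of [f] is a
    summand of the kernel of [q], with complement [Q]. *)
Lemma weq_trivial_fibration X Y (f : mor X Y) :
  fib (singular_projective R) f -> weq (singular_projective R) f ->
  trivial_fibration f.
Proof.
move=> fe [E [j [q [fqj jm [Q [c [jc Qp]]] qe [K [i [ik Kt]]]]]]].
split=> [|P t PP tc ft]; first exact: epi_termwise.
have jk := mono_kernel_cokernel hk hb hN jm jc.
have jmn := mono_termwise hk jm.
have ikn := is_kernel_termwise hk ik; have imn n := kernel_mono (ikn n).
have [s0 cs0] := Qp _ _ c (cokernel_epi jc) (idm Q).
have [b fb] := Qp _ _ f fe (q \oc s0).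
have [tau [qtau ctau]] : exists tau : mor Q E, q \oc tau = 0 /\ c \oc tau = idm
  Q.
  exists (s0 - j \oc b); rewrite !compBr !compA -fqj fb subrr.
  by rewrite jc.1 comp0m subr0.
have /dependent_choice[t' t'E] n : exists t' : mor (P (n + 1)) (K n),
    at_deg i n \oc t' = at_deg j n \oc t n.
  apply: (kernel_lift (ikn n)).
  by rewrite compA -at_degM -fqj ft.
have [|s' s'E] := sp_trivial_coboundary PP Kt (t := t').
  apply: (cocycle_cancel imn) => n; rewrite !t'E.
  exact: (cocycle_comp j tc).
(* [e] projects the kernel of [q] onto that of [f]. *)
pose e : mor E E := idm E - tau \oc c.
have ce : c \oc e = 0 by rewrite compBr compm1 compA ctau comp1m subrr.
have ej : e \oc j = j by rewrite compBl comp1m -compA jc.1 compm0 subr0.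
have qe' : q \oc e = q by rewrite compBr compm1 compA qtau comp0m subr0.
have /dependent_choice[s sE] n : exists s : mor (P n) (X n),
    at_deg j n \oc s = at_deg e n \oc (at_deg i n \oc s' n).
  by apply: (kernel_lift (jk n)); rewrite compA -at_degM ce comp0m.
exists s; split; last first.
  move=> n; rewrite fqj at_degM -compA sE compA -at_degM qe' compA -at_degM.
  by rewrite ik.1 comp0m.
apply: (coboundary_cancel jmn) => n; rewrite !sE.
rewrite -{1}ej at_degM -compA -t'E.
exact: (coboundary_comp e (coboundary_comp i s'E)).
Qed.

End TrivialFibrations.

(** * Projective resolutions as complexes *)

Section Resolutions.
Variable D : preadditive.

(** A resolution of [J] placed in degree [n], with the projections [p m] to its
    syzygies. Exactness takes the form of lifting and vanishing properties of
    maps, as [D] is an abstract category. *)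
Record resolution n (J : D) (N : Ch D) (Z : int -> D)
    (p : forall m, mor (N m) (Z m)) (e : mor (N n) J) : Prop := Resolution {
  res_epi : epi e;
  res_start : forall X (g : mor X (N n)), e \oc g = 0 -> p n \oc g = 0;
  res_aug : e \oc bdry N n = 0;
  res_lift : forall m X (g : mor X (N m)), n <= m -> projective X ->
    p m \oc g = 0 -> exists g', bdry N m \oc g' = g;
  res_exact : forall m X (g : mor X (N (m + 1))), n <= m ->
    bdry N m \oc g = 0 -> p (m + 1) \oc g = 0;
  res_zero : forall m, m < n -> zero_object (N m)
}.

Section Lifting.
Variables (n : int) (J : D) (N : Ch D) (Z : int -> D).
Variables (p : forall m, mor (N m) (Z m)) (e : mor (N n) J).
Hypothesis Nres : resolution p e.
Variable X : Ch D.
Hypothesis Xproj : forall m, projective (X m).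

(** Comparison of the complex of projectives [X] with the resolution: cocycles
    on [X] with values in [N] are determined up to coboundaries by their
    augmentation, a map to [J] that vanishes on boundaries. *)
Lemma cocycle_exists (phi : mor (X (n + 1)) J) : phi \oc bdry X (n + 1) = 0 ->
  exists t : forall m, mor (X (m + 1)) (N m), cocycle t /\ e \oc t n = phi.
Proof.
move=> phid; have [t0 et0] := Xproj (res_epi Nres) phi.
have [|m x nm gx|t [tn _ tR]] := @int_recursion
    (fun m => mor (X (m + 1)) (N m))
    (fun m x => p m \oc (x \oc bdry X (m + 1)) = 0)
    (fun m x y => bdry N m \oc y + x \oc bdry X (m + 1) = 0)
    (fun=> 0) n t0.
- by apply: (res_start Nres); rewrite compA et0.
- have [|y yE] := res_lift Nres (g := - (x \oc bdry X (m + 1))) nm (@Xproj _).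
    by rewrite compmN gx oppr0.
  exists y; split; last by rewrite yE addNr.
  apply: (res_exact Nres nm).
  by rewrite compA yE compNm -compA diffK compm0 oppr0.
exists t; split=> [m|]; last by rewrite tn.
have [mn|nm] := ltP m n; last exact: (tR _ nm).2.
exact: to_zero_object (res_zero Nres mn).
Qed.

Lemma coboundary_exists (t : forall m, mor (X (m + 1)) (N m))
    (psi : mor (X n) J) :
  cocycle t -> e \oc t n = psi \oc bdry X n -> exists s, coboundary t s.
Proof.
move=> tc te; have [s0 es0] := Xproj (res_epi Nres) (- psi).
have [|m x nm gx|s [_ _ sR]] := @int_recursion
    (fun m => mor (X m) (N m))
    (fun m x => p m \oc (t m + x \oc bdry X m) = 0)
    (fun m x y => bdry N m \oc y = t m + x \oc bdry X m)
    (fun=> 0) n s0.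
- by apply: (res_start Nres); rewrite compDr compA es0 te compNm subrr.
- have [y yE] := res_lift Nres nm (@Xproj _) gx; exists y; split=> //.
  apply: (res_exact Nres nm).
  by rewrite compDr compA yE compDl -compA diffK compm0 addr0 tc.
exists s => m; have [mn|nm] := ltP m n.
  by rewrite [LHS](to_zero_object _ (res_zero Nres mn))
    [RHS](to_zero_object _ (res_zero Nres mn)).
by rewrite (sR _ nm).2 addrK.
Qed.

End Lifting.
End Resolutions.

(** * Relative projectivity *)

Section Relative.
Variables (C D : preadditive) (U : additive_functor C D).

(** The objects on which homological algebra can be transported along [U]: out
    of a complex of such objects, maps, cocycles and coboundaries are the same
    before and after applying [U]. *)
Definition U_projective (V : C) := projective (U V) /\
  forall W (h : mor (U V) (U W)), exists! f : mor V W, fmap U f = h.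

Lemma U_full V W (h : mor (U V) (U W)) : U_projective V ->
  exists f : mor V W, fmap U f = h.
Proof. by move=> [_ /(_ W h)[f [? _]]]; exists f. Qed.

Lemma U_faithful V W (f g : mor V W) : U_projective V ->
  fmap U f = fmap U g -> f = g.
Proof. by move=> [_ /(_ W (fmap U g))[h [_ hu]]] fg;
  rewrite -(hu f)// (hu g). Qed.

Lemma fmapN V W (f : mor V W) : fmap U (- f) = - fmap U f.
Proof. by apply: (addrI (fmap U f)); rewrite -fmapD !subrr fmap0. Qed.

Lemma U_projective_retract V V' (i : mor V V') (r : mor V' V) :
  r \oc i = idm V -> U_projective V' -> U_projective V.
Proof.
move=> ri V'P; have Uri : fmap U r \oc fmap U i = idm _ by rewrite -fmapM ri
  fmap1.
split=> [|W h]; first exact: retract_projective Uri V'P.1.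
have [f' f'E] := U_full (h \oc fmap U r) V'P.
exists (f' \oc i); split=> [|g gE].
  by rewrite fmapM f'E -compA Uri compm1.
rewrite -[g]compm1 -ri compA; congr (_ \oc _).
by apply: (U_faithful V'P); rewrite fmapM gE.
Qed.

Lemma U_projective_lift V Y Z (f : mor Y Z) (g : mor V Z) : U_projective V ->
  epi (fmap U f) -> exists h : mor V Y, f \oc h = g.
Proof.
move=> VP fe; have [h' h'E] := VP.1 _ _ _ fe (fmap U g).
have [h hE] := U_full h' VP; exists h.
by apply: (U_faithful VP); rewrite fmapM hE.
Qed.

(** Each syzygy is covered by some [U V]. The boundaries are then maps between
    values of [U], and those out of a [U_projective] object come from [C]. *)
Lemma U_resolution_exists (V0 : C) : has_kernels C -> has_kernels D ->
  (forall Z : D, exists V, U_projective V /\ exists e : mor (U V) Z, epi e) ->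
  forall (J : D) n, exists (N : Ch C) (Z : int -> D)
    (p : forall m, mor (ch_functor U N m) (Z m))
    (e : mor (ch_functor U N n) J), resolution p e.
Proof.
move=> hkC hkD enough J n.
have [O O0] := zero_object_exists V0 hkC.
pose T : Type := {V : C & {Z : D & mor (U V) Z}}.
pose V (x : T) : C := projT1 x; pose Z (x : T) : D := projT1 (projT2 x).
pose p (x : T) : mor (U (V x)) (Z x) := projT2 (projT2 x).
pose mk V Z (p : mor (U V) Z) : T := existT _ V (existT _ Z p).
have [V1 [V1P [e0 e0e]]] := enough J.
have [|m x nm [xP xe]|f [fn fz fR]] := @int_recursion (fun=> T)
    (fun _ x => U_projective (V x) /\ epi (p x))
    (fun _ x y => exists j : mor (Z y) (U (V x)), is_kernel (p x) j)
    (fun=> mk O (U O) 0) n (mk V1 J e0) => //.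
  have [K [k kk]] := hkD _ _ (p x); have [V2 [V2P [e2 e2e]]] := enough K.
  by exists (mk V2 K e2); split=> //; exists k.
have fP m : n <= m -> U_projective (V (f m)) by move=> /fR[[]].
have /dependent_choice[d dP] m : exists d : mor (V (f (m + 1))) (V (f m)),
    (n <= m -> exists2 j : mor (Z (f (m + 1))) (U (V (f m))),
       is_kernel (p (f m)) j & fmap U d = j \oc p (f (m + 1))) /\
    (m < n -> d = 0).
  have [mn|nm] := ltP m n; first by exists 0.
  have [_ [j jk]] := fR m nm.
  have nm1 : n <= m + 1 by rewrite (le_trans nm)// lerDl.
  have [d dE] := U_full (j \oc p (f (m + 1))) (fP _ nm1).
  by exists d; split=> // _; exists j.
have dK m : d m \oc d (m + 1) = 0.
  have [mn|nm] := ltP m n; first by rewrite (dP m).2// comp0m.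
  have nm1 : n <= m + 1 by rewrite (le_trans nm)// lerDl.
  have nm2 : n <= m + 1 + 1 by rewrite (le_trans nm1)// lerDl.
  have [j jk dE] := (dP m).1 nm; have [j' jk' dE'] := (dP (m + 1)).1 nm1.
  apply: (U_faithful (fP _ nm2)); rewrite fmap0 fmapM dE dE'.
  by rewrite !compA -[j \oc _ \oc _]compA jk'.1 compm0 comp0m.
have [e [ee ep pe]] : exists e : mor (U (V (f n))) J, [/\ epi e,
    forall X (g : mor X (U (V (f n)))), e \oc g = 0 -> p (f n) \oc g = 0
    & forall X (g : mor X (U (V (f n)))), p (f n) \oc g = 0 -> e \oc g = 0].
  by rewrite fn; exists e0.
exists (Chain dK), (fun m => Z (f m)), (fun m => p (f m)), e.
split=> //= [|m X g nm Xp|m X g nm|m mn].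
- have [j jk dE] := (dP n).1 (lexx n).
  by rewrite dE; apply: pe; rewrite compA jk.1 comp0m.
- have [j jk dE] := (dP m).1 nm; move=> /(kernel_lift jk)[g0 <-].
  have nm1 : n <= m + 1 by rewrite (le_trans nm)// lerDl.
  have [[_ pe1] _] := fR _ nm1.
  have [g' g'E] := Xp _ _ _ pe1 g0.
  by exists g'; rewrite dE -compA g'E.
- have [j jk dE] := (dP m).1 nm; rewrite dE -compA.
  exact: (mono0 (kernel_mono jk)).
- by rewrite /zero_object -fmap1 fz//= O0 fmap0.
Qed.

End Relative.

(** * Cofibrations of the transferred model structure *)

Section Transfer.
Variables (C : preadditive) (R : pzRingType) (U : additive_functor C (Mod R)).
Hypotheses (hkC : has_kernels C) (hbC : has_biproducts C).
Hypotheses (hkM : has_kernels (Mod R)) (hbM : has_biproducts (Mod R)).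
Local Notation CU := (ch_functor U).

Definition lifts_trivial_fibrations (V W : Ch C) (i : mor V W) :=
  forall (Y Z : Ch C) (f : mor Y Z), trivial_fibration (fmap CU f) ->
    has_llp i f.

(** A termwise lift exists by relative projectivity; its failure to be a chain
    map is a cocycle on the cokernel with values in the kernel of [f], which is
    a coboundary because [f] is a trivial fibration. *)
Lemma split_mono_lifts (V W Q : Ch C) (i : mor V W) (q : mor W Q) :
  (forall n, split_mono (at_deg i n)) -> is_cokernel i q ->
  (forall n, U_projective U (Q n)) -> acyclic (CU Q) ->
  lifts_trivial_fibrations i.
Proof.
move=> /dependent_choice[r ri] qc Qp Qa Y Z f [fe fP] u v fu.
have [s sP] := split_cokernel hkC ri qc.
have qs n : at_deg q n \oc s n = idm _ by case: (sP n).
have qi n : at_deg q n \oc at_deg i n = 0 by rewrite -at_degM qc.1.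
have /dependent_choice[m fm] n : exists m, at_deg f n \oc m = at_deg v n \oc s
  n.
  exact: U_projective_lift (Qp n) (fe n).
pose l0 n := at_deg u n \oc r n + m n \oc at_deg q n.
have l0i n : l0 n \oc at_deg i n = at_deg u n.
  by rewrite compDl -!compA ri qi compm0 addr0 compm1.
have fl0 n : at_deg f n \oc l0 n = at_deg v n.
  have [_ _ one] := sP n.
  by rewrite compDr !compA fm -at_degM fu -!compA -compDr one compm1.
pose D n := bdry Y n \oc l0 (n + 1) - l0 n \oc bdry W n.
have Di n : D n \oc at_deg i (n + 1) = 0.
  rewrite compBl -!compA l0i -[bdry W n \oc _]at_deg_bdry [l0 n \oc _]compA l0i.
  by rewrite at_deg_bdry subrr.
have [t tE] : exists t, forall n, t n = D n \oc s (n + 1) by eexists.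
have tq n : t n \oc at_deg q (n + 1) = D n.
  have [_ _ one] := sP (n + 1).
  by rewrite tE -[RHS]compm1 -one compDr compA Di comp0m add0r compA.
have tc : cocycle t.
  move=> n; apply: (section_epi (qs (n + 1 + 1))).
  rewrite comp0m compDl -[_ \oc bdry Q _ \oc _]compA -at_deg_bdry !compA tq.
  rewrite -[_ \oc at_deg q _]compA tq.
  exact: (@defect_cocycle _ W Y).
have ft n : at_deg f n \oc t n = 0.
  rewrite tE compA compBr !compA at_deg_bdry -[_ \oc at_deg f _ \oc _]compA
    !fl0.
  by rewrite at_deg_bdry subrr comp0m.
have Up n : projective (CU Q n) := (Qp n).1.
have [||s' [ts fs]] := fP (CU Q) (fun n => fmap U (t n)) (conj Qa Up).
- by move=> n; rewrite -[LHS]/(fmap U _ \oc fmap U _ + fmap U _ \oc fmap U _)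
    -!fmapM -fmapD tc fmap0.
- by move=> n; rewrite -[LHS]/(fmap U _ \oc fmap U _) -fmapM ft fmap0.
have /dependent_choice[h hE] n : exists h : mor (Q n) (Y n), fmap U h = s' n.
  exact: U_full.
have fh n : at_deg f n \oc h n = 0.
  by apply: (U_faithful (Qp n)); rewrite fmapM hE fmap0 fs.
have th n : t n = bdry Y n \oc h (n + 1) - h n \oc bdry Q n.
  apply: (U_faithful (Qp (n + 1))).
  by rewrite ts fmapD fmapN !fmapM !hE.
have [|l lE] := @ch_mor _ W Y (fun n => l0 n - h n \oc at_deg q n).
  move=> n; have E1 : bdry Y n \oc (h (n + 1) \oc at_deg q (n + 1))
      - h n \oc at_deg q n \oc bdry W n
      = bdry Y n \oc l0 (n + 1) - l0 n \oc bdry W n.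
    by rewrite -[RHS]tq th compBl -!compA at_deg_bdry.
  rewrite compBl compBr -[bdry Y n \oc l0 _](subrK (l0 n \oc bdry W n)) -E1.
  by rewrite [RHS]addrAC [X in _ = X + _]addrAC subrr add0r; exact: addrC.
exists l; split; apply: ch_ext => n; rewrite at_degM lE.
  by rewrite compBl l0i -compA qi compm0 subr0.
by rewrite compBr fl0 compA fh comp0m subr0.
Qed.

(** The disk on a family of maps that become epi under [U] becomes a trivial
    fibration, its kernel being contractible. *)
Lemma disk_morph_trivial_fibration (A B : int -> C) (E F : Ch C)
    (p : forall n, mor (E n) (A n)) (j : forall n, mor (A n) (E n))
    (s : forall n, mor (A n) (E (n + 1)))
    (p' : forall n, mor (F n) (B n)) (j' : forall n, mor (B n) (F n))
    (s' : forall n, mor (B n) (F (n + 1)))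
    (g : forall n, mor (A n) (B n)) (f : mor E F) :
  is_disk p j s -> is_disk p' j' s' ->
  (forall n, p' n \oc at_deg f n = g n \oc p n) ->
  (forall n, epi (fmap U (g n))) -> trivial_fibration (fmap CU f).
Proof.
move=> Ed Fd fg ge; split=> [n|P t PP tc ft].
  by change (epi (fmap U (at_deg f n))); apply: (disk_morph_epi Ed Fd fg).
have [h hE] := reindex_succ (T := fun n => mor (P n) (U (E n)))
  (fun n => fmap U (s n \oc p n) \oc t n).
exists h; split; apply: int_succ_ind => n.
  rewrite !hE -[bdry (CU E) _]/(fmap U _) -[_ \oc t n \oc _]compA.
  rewrite (cocycle_anti n tc) compmN opprK !compA -[bdry (CU E) _]/(fmap U _)
    -!fmapM -compDl -fmapD.
  by rewrite (disk_contraction Ed) fmap1 comp1m.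
rewrite hE compA -[at_deg (fmap CU f) _]/(fmap U _) -fmapM.
rewrite (disk_morph_contraction Ed Fd fg) fmapM -compA.
by rewrite (ft n : fmap U _ \oc _ = 0) compm0.
Qed.

Section Cofibration.
Variables (V W : Ch C) (i : mor V W).
Hypothesis i_lifts : lifts_trivial_fibrations i.

(** Chain maps to disks being families of maps, lifting against disks is lifting
    in all degrees at once, without regard to the boundaries. *)
Lemma termwise_lift (A B : int -> C) (g : forall n, mor (A n) (B n))
    (u : forall n, mor (V n) (A n)) (v : forall n, mor (W n) (B n)) :
  (forall n, epi (fmap U (g n))) ->
  (forall n, g n \oc u n = v n \oc at_deg i n) ->
  exists l : forall n, mor (W n) (A n),
    forall n, l n \oc at_deg i n = u n /\ g n \oc l n = v n.
Proof.
move=> ge gu.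
have [E [p [j [s Ed]]]] := disk_exists A hbC.
have [F [p' [j' [s' Fd]]]] := disk_exists B hbC.
have [f fE] := disk_map_exists Fd (fun n => g n \oc p n).
have [x xE] := disk_map_exists Ed u; have [y yE] := disk_map_exists Fd v.
have [|l [li fl]] := i_lifts (disk_morph_trivial_fibration Ed Fd fE ge) (u := x)
  (v := y).
  apply: (disk_map_inj Fd) => n.
  by rewrite !at_degM !compA fE yE -compA xE gu.
exists (fun n => p n \oc at_deg l n) => n.
by rewrite -compA -at_degM li xE compA -fE -compA -at_degM fl yE.
Qed.

(** Retractions are lifts of the identity against [V n -> 0]. *)
Lemma lifts_split_mono : forall n, split_mono (at_deg i n).
Proof.
have [O O0] := zero_object_exists (V 0) hkC.
have [|n|r rE] := @termwise_lift (fun n => V n) (fun=> O) (fun=> 0)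
  (fun n => idm (V n)) (fun=> 0).
- move=> n; apply: epiP => Z h _; apply: from_zero_object.
  by rewrite /zero_object -fmap1 O0 fmap0.
- by rewrite !comp0m.
by move=> n; exists (r n); have [-> _] := rE n.
Qed.

Variables (Q : Ch C) (q : mor W Q).
Hypothesis qc : is_cokernel i q.

(** The lifts of [q] along [g] that vanish on [V] descend to sections of [g]. *)
Lemma lifts_cokernel_retract (A : int -> C) (g : forall n, mor (A n) (Q n)) :
  (forall n, epi (fmap U (g n))) -> forall n, split_epi (g n).
Proof.
move=> ge.
have [n|l lE n] := termwise_lift (u := fun=> 0) (v := fun n => at_deg q n) ge.
  by rewrite compm0 -at_degM qc.1.
have /dependent_choice[r ri] := lifts_split_mono.
have [s /(_ n)[qs _ _]] := split_cokernel hkC ri qc.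
by exists (l n \oc s n); rewrite compA (lE n).2 qs.
Qed.

(** Cocycles on the cokernel are off-diagonal entries of extensions, which split
    because they are trivial fibrations. *)
Lemma lifts_coboundary (Y : Ch C) (t : forall n, mor (Q (n + 1)) (Y n)) :
  (forall (P : Ch (Mod R)) (t' : forall n, mor (P (n + 1)) (CU Y n)),
     acyclic_projective P -> cocycle t' -> exists s', coboundary t' s') ->
  cocycle t -> exists s, coboundary t s.
Proof.
move=> Yt tc; have [E [j [e [p [s [EP ds]]]]]] := twisted_extension hbC tc.
have e_tf : trivial_fibration (fmap CU e).
  split=> [n|P t1 PP t1c et1].
    have [_ es _ _ _] := EP n; apply: (@section_epi _ _ _ _ (fmap U (s n))).
    by rewrite -[LHS]/(fmap U _ \oc fmap U _) -fmapM es fmap1.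
  have jp n X (g : mor X (U (E n))) : fmap U (at_deg e n) \oc g = 0 ->
      fmap U (at_deg j n) \oc (fmap U (p n) \oc g) = g.
    move=> eg; have [_ _ _ _ one] := EP n.
    rewrite compA -[RHS]comp1m -fmap1 -one fmapD compDl !fmapM.
    by rewrite -[fmap U (s n) \oc _ \oc _]compA eg compm0 addr0.
  have jm n : mono (at_deg (fmap CU j) n).
    have [pj _ _ _ _] := EP n; apply: (@retraction_mono _ _ _ _ (fmap U (p n))).
    by rewrite -[LHS]/(fmap U _ \oc fmap U _) -fmapM pj fmap1.
  pose t2 n := fmap U (p n) \oc t1 n.
  have t2E n : at_deg (fmap CU j) n \oc t2 n = t1 n by exact: jp (et1 n).
  have t2c : @cocycle _ P (CU Y) t2.
    apply: (cocycle_cancel jm) => n; rewrite !t2E; exact: t1c.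
  have [s2 s2E] := Yt P t2 PP t2c.
  exists (fun n => at_deg (fmap CU j) n \oc s2 n); split=> n.
    rewrite -t2E; exact: (coboundary_comp (fmap CU j) s2E).
  have [_ _ _ ej _] := EP n.
  by rewrite compA -[X in X \oc _]/(fmap U _ \oc fmap U _) -fmapM ej fmap0
    comp0m.
have [|l [li el]] := i_lifts e_tf (u := 0) (v := q).
  by rewrite compm0 qc.1.
have [u uE] := cokernel_desc qc li.
apply: (section_coboundary EP ds (u := u)).
by apply: (cokernel_epi qc); rewrite -compA uE el comp1m.
Qed.

(** Injectivity of [J], as far as it is needed to make a resolution of [J]
    trivial: only for the inclusions of the images of the boundaries. *)
Definition extends_from_acyclic (J : Mod R) :=
  forall (P : Ch (Mod R)) n (phi : mor (P (n + 1)) J), acyclic_projective P ->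
    phi \oc bdry P (n + 1) = 0 -> exists psi, phi = psi \oc bdry P n.

(** Homology of [U Q] is detected by maps to modules [J] as above. Such a map is
    a cocycle on [U Q] with values in [J], or in a resolution [U N] of [J] by
    relative projectives. In the latter form it is one on [Q] with values in
    [N], to which [lifts_coboundary] applies. *)
Lemma lifts_acyclic :
  (forall Z : Mod R, exists A, U_projective U A /\ exists e : mor (U A) Z,
    epi e) ->
  (forall (A B : Mod R) (f : mor A B), exists (J : Mod R) (h : mor B J),
     extends_from_acyclic J /\
     forall x, mod_fun h x = 0 <-> exists a, mod_fun f a = x) ->
  (forall n, U_projective U (Q n)) -> acyclic (CU Q).
Proof.
move=> enough detect Qp n x dx.
have [J [h [Jext hP]]] := detect _ _ (bdry (CU Q) (n + 1)).
apply/hP.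
have [N [Z [p [e Nres]]]] := U_resolution_exists (V 0) hkC hkM enough J n.
have [|t [tc et]] := cocycle_exists Nres (X := CU Q) (fun m => (Qp m).1)
  (phi := h).
  by apply: mod_hom_ext => y; apply/hP; exists y.
have /dependent_choice[t' t'E] m : exists t' : mor (Q (m + 1)) (N m),
  fmap U t' = t m.
  exact: U_full.
have [P t1 PP t1c||s st] := @lifts_coboundary N t'.
- have [|psi psiE] := Jext P n (e \oc t1 n) PP.
    by rewrite -compA (cocycle_anti n t1c) compmN compA (res_aug Nres) comp0m
      oppr0.
  by have [s1 s1E] := coboundary_exists Nres PP.2 t1c psiE; exists s1.
- move=> m; apply: (U_faithful (Qp _)); rewrite fmap0 fmapD !fmapM !t'E.
  exact: tc.
have {}et : h = - (e \oc fmap U (s n)) \oc bdry (CU Q) n.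
  rewrite -et -t'E st fmapD fmapN !fmapM compBr compA.
  by rewrite (res_aug Nres : e \oc fmap U _ = 0) comp0m sub0r compNm compA.
by rewrite et -[LHS]/(mod_fun _ (mod_fun (bdry (CU Q) n) x)) dx linear0.
Qed.

End Cofibration.
End Transfer.

(** * Categories of modules *)

Section Modules.
Variable R : pzRingType.
Implicit Types A B M : lmodType R.

Lemma linear_map A B (f : A -> B) : linear f ->
    exists F : {linear A -> B}, F =1 f.
Proof.
move=> fl; pose l := GRing.isLinear.Build R A B _ f fl.
by exists (HB.pack f l : {linear A -> B}).
Qed.

Section Kernel.
Variables (A B : lmodType R) (f : {linear A -> B}).

Definition ker_pred : {pred A} := fun x => f x == 0.
Definition ker := {x : A | ker_pred x}.
HB.instance Definition _ := SubType.on ker.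
HB.instance Definition _ := Choice.on ker.

Fact ker_submod : submod_closed ker_pred.
Proof.
split=> [|a x y]; rewrite !unfold_in /ker_pred; first by rewrite linear0.
by move=> /eqP fx /eqP fy; rewrite linearP fx fy scaler0 addr0.
Qed.
HB.instance Definition _ := GRing.isSubmodClosed.Build R A ker_pred
  (GRing.submod_closed_semi ker_submod).
HB.instance Definition _ := [SubChoice_isSubLmodule of ker by <:].

Lemma kerP (x : ker) : f (\val x) = 0.
Proof. by apply/eqP; exact: (valP x). Qed.

Lemma ker_sub x : f x = 0 -> exists y : ker, \val y = x.
Proof. by move=> /eqP fx; exists (Sub x fx). Qed.

Lemma ker_lift M (g : {linear M -> A}) : (forall x, f (g x) = 0) ->
  exists h : {linear M -> ker}, forall x, \val (h x) = g x.
Proof.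
move=> fg; have /dependent_choice[h hE] x := ker_sub (fg x).
have [|H HE] := @linear_map M ker h.
  by move=> a x y; apply: val_inj; rewrite hE linearP /= !hE.
by exists H => x; rewrite HE hE.
Qed.
End Kernel.

Lemma Mod_has_kernels : has_kernels (Mod R).
Proof.
move=> A B f; pose k : mod_hom (ker f) A := (\val : {linear ker f -> A}).
exists (ker f : Mod R), k; apply: is_kernelP.
- by apply: mod_hom_ext => x; exact: kerP.
- move=> Z g h gh; apply: mod_hom_ext => x; apply: val_inj.
  exact: (congr1 (fun u : mod_hom Z A => (u : {linear Z -> A}) x) gh).
move=> Z g fg; have [x|h hE] := @ker_lift _ _ f _ (mod_fun g).
  exact: (congr1 (fun u : mod_hom Z B => (u : {linear Z -> B}) x) fg).
by exists h; apply: mod_hom_ext.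
Qed.

Section Product.
Variables A B : lmodType R.

Fact pair_inl_linear : linear (fun a : A => (a, 0) : (A * B)%type).
Proof. by move=> a x y; apply: injective_projections;
  rewrite /= ?scaler0 ?addr0. Qed.
Fact pair_inr_linear : linear (fun b : B => (0, b) : (A * B)%type).
Proof. by move=> a x y; apply: injective_projections;
  rewrite /= ?scaler0 ?addr0. Qed.

Definition pair_inl : {linear A -> (A * B)%type} :=
  HB.pack (fun a : A => (a, 0) : (A * B)%type)
    (GRing.isLinear.Build R A _ _ _ pair_inl_linear).
Definition pair_inr : {linear B -> (A * B)%type} :=
  HB.pack (fun b : B => (0, b) : (A * B)%type)
    (GRing.isLinear.Build R B _ _ _ pair_inr_linear).
End Product.

Lemma Mod_has_biproducts : has_biproducts (Mod R).
Proof.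
move=> A B; exists ((A * B)%type : Mod R), (pair_inl A B : mod_hom _ _),
  (pair_inr A B : mod_hom _ _), (fst : {linear (A * B)%type -> A}),
  (snd : {linear (A * B)%type -> B}).
split; apply: mod_hom_ext => //= -[a b] /=.
by apply: injective_projections; rewrite /= ?addr0 ?add0r.
Qed.

Lemma surjective_epi (A B : Mod R) (f : mor A B) :
  (forall y, exists x, mod_fun f x = y) -> epi f.
Proof.
move=> fs Z g h gh; apply: mod_hom_ext => y; have [x <-] := fs y.
exact: (congr1 (fun u : mod_hom A Z => (u : {linear A -> Z}) x) gh).
Qed.

End Modules.

(** * Vector spaces *)

Section VectorSpaces.
Variable k : fieldType.

(** By Zorn's lemma there is a maximal subspace that meets [S] in zero only; [e]
    is the projection to [S] along it. *)
Lemma complement_exists (V : lmodType k) (S : set V) : S 0 ->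
  (forall a u v, S u -> S v -> S (a *: u + v)) ->
  exists e : {linear V -> V}, (forall v, S (e v)) /\ forall v, S v -> e v = v.
Proof.
move=> S0 Slin.
pose indep : set (set V) := [set T : set V |
  (forall a u v, T u -> T v -> T (a *: u + v)) /\ forall v, T v -> S v ->
    v = 0].
have [|T [[Tlin TS] Tmax]] := @Zorn_bigcup V indep.
  move=> F FI Ftot; split=> [a u v [A FA Au] [B FB Bv]|v [A FA Av]]; last first.
    exact: (FI _ FA).2.
  have [AB|BA] := Ftot _ _ FA FB.
    by exists B => //; apply: (FI _ FB).1 => //; exact: AB.
  by exists A => //; apply: (FI _ FA).1 => //; exact: BA.
have T0 : T 0.
  apply: contrapT => nT0; apply: (Tmax (T `|` [set 0])).
    by split=> [x Tx|/(_ 0)]; [left | move=> /(_ (or_intror erefl))].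
  split=> [a u v [Tu|->] [Tv|->]|v [Tv|->]//]; last exact: TS.
  - by left; exact: Tlin.
  - exfalso; apply: nT0; rewrite -(addNr u) -scaleN1r; exact: Tlin.
  - by left; rewrite scaler0 add0r.
  - by right; rewrite scaler0 addr0.
have dec v : exists s, S s /\ T (v - s).
  apply: contrapT => nv.
  have nTv : ~ T v by move=> Tv; apply: nv; exists 0; rewrite subr0.
  (* [T + kv] would be a larger subspace independent from [S]. *)
  apply: (Tmax [set w | exists a t, T t /\ w = a *: v + t]).
    split=> [t Tt|/(_ v)]; first by exists 0, t; rewrite scale0r add0r.
    by move=> h; apply/nTv/h; exists 1, 0; rewrite scale1r addr0.
  split=> [a u w [b [t [Tt ->]]] [c [t' [Tt' ->]]]|w [a [t [Tt wE]]] Sw].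
    exists (a * b + c), (a *: t + t'); split; first exact: Tlin.
    by rewrite scalerDr scalerA scalerDl addrACA.
  have [a0|a0] := eqVneq a 0.
    by rewrite wE a0 scale0r add0r in Sw *; exact: TS.
  exfalso; apply: nv; exists (a^-1 *: w); split.
    by rewrite -[_ *: w]addr0; exact: Slin.
  rewrite wE scalerDr scalerA mulVf// scale1r opprD addrA subrr sub0r.
  by rewrite -scaleNr -[_ *: t]addr0; exact: Tlin.
have uniq v s s' : S s -> T (v - s) -> S s' -> T (v - s') -> s = s'.
  move=> Ss Ts Ss' Ts'; apply/eqP; rewrite -subr_eq0; apply/eqP/TS.
    have -> : s - s' = (-1) *: (v - s) + (v - s').
      by rewrite scaleN1r opprB addrA subrK.
    exact: Tlin.
  by rewrite addrC -scaleN1r; exact: Slin.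
have [e eP] := dependent_choice dec.
have [|E EE] := @linear_map k V V e.
  move=> a u v; have [Su Tu] := eP u; have [Sv Tv] := eP v.
  have [Sw Tw] := eP (a *: u + v); apply: (uniq _ _ _ Sw Tw); first exact: Slin.
  by rewrite opprD addrACA -scalerBr; exact: Tlin.
exists E; split=> [v|v Sv]; rewrite EE; first by case: (eP v).
have [Se Te] := eP v; apply: (uniq v) => //.
by rewrite subrr.
Qed.

(** Composition with [g] extends to [B] the linear maps on [A] that vanish on
    the kernel of [f], and [y - f (g y)] is linear in [y] and vanishes exactly
    on the image of [f]. *)
Lemma generalized_inverse (A B : lmodType k) (f : {linear A -> B}) :
  exists g : {linear B -> A}, forall x, f (g (f x)) = f x.
Proof.
have [||e [eS eE]] := @complement_exists B (range f).
- by exists 0; rewrite ?linear0.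
- by move=> a _ _ [x _ <-] [y _ <-]; exists (a *: x + y); rewrite ?linearP.
have [||p [pS pE]] := @complement_exists A [set x | f x = 0].
- exact: linear0.
- by move=> a x y /= fx fy; rewrite linearP fx fy scaler0 addr0.
have /dependent_choice[h hE] y : exists x, f x = e y by have [x _ <-] := eS y;
  exists x.
have pf x y : f x = f y -> x - p x = y - p y.
  move=> fxy; have pB : p x - p y = x - y.
    by rewrite -linearB pE//= linearB fxy subrr.
  rewrite -{1}[x](subrK y) -pB [LHS]addrAC [X in X + _ = _]addrAC.
  by rewrite subrr add0r addrC.
have [|g gE] := @linear_map k B A (fun y => h y - p (h y)).
  move=> a x y; have -> : h (a *: x + y) - p (h (a *: x + y))
      = a *: h x + h y - p (a *: h x + h y).
    by apply: pf; rewrite linearP !hE linearP.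
  by rewrite linearP opprD addrACA -scalerBr.
exists g => x; rewrite gE linearB (pS (h (f x)) : f (p _) = 0) subr0 hE.
by apply: eE; exists x.
Qed.

End VectorSpaces.

(** * Modules over an algebra *)

Section Algebra.
Variables (k : fieldType) (R : pzRingType) (iota : {rmorphism k -> R}).

Definition restrict (M : lmodType R) : Type := M.
HB.instance Definition _ M := GRing.Zmodule.on (restrict M).

Section Restrict.
Variable M : lmodType R.
Definition restrict_scale (a : k) (x : restrict M) : restrict M :=
  iota a *: (x : M).
Fact restrict_scaleA a b x :
  restrict_scale a (restrict_scale b x) = restrict_scale (a * b) x.
Proof. by rewrite /restrict_scale rmorphM scalerA. Qed.
Fact restrict_scale1 : left_id 1 restrict_scale.
Proof. by move=> x; rewrite /restrict_scale rmorph1 scale1r. Qed.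
Fact restrict_scaleDr : right_distributive restrict_scale +%R.
Proof. by move=> a x y; exact: scalerDr. Qed.
Fact restrict_scaleDl x : {morph restrict_scale^~ x : a b / a + b}.
Proof. by move=> a b; rewrite /restrict_scale rmorphD scalerDl. Qed.
HB.instance Definition _ := GRing.Zmodule_isLmodule.Build k (restrict M)
  restrict_scaleA restrict_scale1 restrict_scaleDr restrict_scaleDl.
End Restrict.

Lemma restrict_linear (M N : lmodType R) (f : {linear M -> N}) :
  exists g : {linear restrict M -> restrict N}, forall x, g x = f x.
Proof.
have [|g gE] := @linear_map k (restrict M) (restrict N) f; last by exists g.
by move=> a x y; exact: linearP.
Qed.

Definition coinduced (T : lmodType k) : Type := mod_hom (restrict R^o) T.
HB.instance Definition _ T := GRing.Zmodule.on (coinduced T).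

Section Coinduced.
Variable T : lmodType k.

Definition coind_fun (phi : coinduced T) : {linear restrict R^o -> T} := phi.

Lemma coind_exists (f : R -> T) : linear (f : restrict R^o -> T) ->
  exists phi : coinduced T, forall r, coind_fun phi r = f r.
Proof. by move=> /linear_map[phi phiE]; exists phi. Qed.

Lemma coind_ext (phi psi : coinduced T) :
  (forall r, coind_fun phi r = coind_fun psi r) -> phi = psi.
Proof. exact: mod_hom_ext. Qed.

Fact coind_scale_linear (h : R) (phi : coinduced T) :
  linear (fun r : restrict R^o => coind_fun phi ((r : R) * h)).
Proof.
move=> a x y; rewrite -linearP; congr (coind_fun phi _).
by rewrite [LHS]mulrDl; congr (_ + _); exact/esym/mulrA.
Qed.

Definition coind_scale (h : R) (phi : coinduced T) : coinduced T :=
  HB.pack (fun r : restrict R^o => coind_fun phi ((r : R) * h))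
    (GRing.isLinear.Build k _ _ _ _ (coind_scale_linear h phi))
  : {linear restrict R^o -> T}.

Fact coind_scaleA a b x :
  coind_scale a (coind_scale b x) = coind_scale (a * b) x.
Proof.
by apply: coind_ext => r; rewrite /= /coind_fun/=; congr (x _);
  exact/esym/mulrA.
Qed.
Fact coind_scale1 : left_id 1 coind_scale.
Proof. by move=> x; apply: coind_ext => r; congr (coind_fun x _);
  exact: mulr1. Qed.
Fact coind_scaleDr : right_distributive coind_scale +%R.
Proof. by move=> a x y; apply: coind_ext. Qed.
Fact coind_scaleDl x : {morph coind_scale^~ x : a b / a + b}.
Proof.
move=> a b; apply: coind_ext => r.
by rewrite -[RHS]/(coind_fun x _ + coind_fun x _) -linearD;
  congr (coind_fun x _);
  exact: mulrDr.
Qed.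
HB.instance Definition _ := GRing.Zmodule_isLmodule.Build R (coinduced T)
  coind_scaleA coind_scale1 coind_scaleDr coind_scaleDl.

Lemma coind_scaleE h (phi : coinduced T) r :
  coind_fun (h *: phi) r = coind_fun phi (r * h).
Proof. by []. Qed.

Lemma coind_adjoint (M : lmodType R) (f : {linear restrict M -> T}) :
  exists F : {linear M -> coinduced T}, forall x r, coind_fun (F x) r = f
    (r *: x).
Proof.
have /dependent_choice[F FE] (x : M) : exists phi : coinduced T,
    forall r : R, coind_fun phi r = f (r *: x).
  apply: coind_exists => a r s; rewrite -linearP; congr (f _).
  by rewrite [LHS]scalerDl -scalerA.
have [|G GE] := @linear_map R M (coinduced T) F.
  move=> a x y; apply: coind_ext => r.
  rewrite -[RHS]/(coind_fun (a *: F x) r + coind_fun (F y) r) coind_scaleE !FE.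
  by rewrite -linearD scalerDr scalerA.
by exists G => x r; rewrite GE FE.
Qed.

End Coinduced.

(** Maps to the coinduced module are [k]-linear maps to [T], and these extend
    along a boundary map by means of a generalized inverse [g] of it. *)
Lemma coinduced_extends (T : lmodType k) :
  extends_from_acyclic (coinduced T : Mod R).
Proof.
move=> P n phi [Pa _] phid.
have [d dE] := restrict_linear (mod_fun (bdry P n)).
have [g gP] := generalized_inverse d.
have [|f fE] := @linear_map k (restrict (P (n + 1))) T
    (fun x => coind_fun (mod_fun phi x) 1).
  move=> a x y; rewrite (linearP (mod_fun phi)).
  rewrite -[LHS]/(coind_fun (iota a *: mod_fun phi x) 1 + coind_fun
    (mod_fun phi y) 1).
  rewrite coind_scaleE mul1r -linearZ; congr (coind_fun _ _ + _).
  by rewrite [RHS]mulr1.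
have [F FE] := coind_adjoint (f \o g : {linear _ -> _}).
exists F; apply: mod_hom_ext => x; apply: coind_ext => r.
rewrite -[RHS]/(coind_fun (F (mod_fun (bdry P n) x)) r) FE /= -linearZ -dE fE.
have [|y yE] := Pa n ((g (d (r *: x)) : P (n + 1)) - r *: x).
  by rewrite linearB -!dE gP subrr.
have : mod_fun phi (g (d (r *: x)) - r *: x) = 0.
  rewrite -yE.
  exact: (congr1 (fun u : mod_hom (P (n + 1 + 1)) (coinduced T) =>
    (u : {linear P (n + 1 + 1) -> coinduced T}) y) phid).
rewrite linearB linearZ => /eqP; rewrite subr_eq0 => /eqP ->.
by rewrite coind_scaleE mul1r.
Qed.

(** The [k]-linear projection [h] off the image of [f] need not be [R]-linear;
    the map that it induces to the coinduced module is. *)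
Lemma image_kernel (A B : Mod R) (f : mor A B) :
  exists (J : Mod R) (h : mor B J), extends_from_acyclic J /\
    forall x, mod_fun h x = 0 <-> exists a, mod_fun f a = x.
Proof.
have [f' f'E] := restrict_linear (mod_fun f).
have [g gP] := generalized_inverse f'.
have [|h hE] := @linear_map k (restrict B) (restrict B) (fun x => x - f' (g x)).
  by move=> a x y; rewrite (linearP g) (linearP f') opprD addrACA -scalerBr.
have [F FE] := coind_adjoint h.
exists (coinduced (restrict B) : Mod R), F; split=> [|x].
  exact: coinduced_extends.
split=> [Fx|[a <-]].
  exists (g x); rewrite -f'E; apply/eqP; rewrite -subr_eq0 -opprB oppr_eq0.
  have := FE x 1; rewrite (Fx : F x = 0) scale1r hE => <-.
  exact/eqP.
apply: coind_ext => r; rewrite -[LHS]/(coind_fun (F _) r) FE hE -linearZ -f'E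
  gP.
by rewrite subrr.
Qed.

Lemma Mod_normal : normal (Mod R).
Proof.
move=> A B f fm; have [J [h [_ hP]]] := image_kernel f.
exists J, h; apply: is_kernelP => // [|Z g hg].
  by apply: mod_hom_ext => x; apply/hP; exists x.
have /dependent_choice[u uE] z : exists a, mod_fun f a = mod_fun g z.
  apply/hP.
  exact: (congr1 (fun u : mod_hom Z J => (u : {linear Z -> J}) z) hg).
have finj a : mod_fun f a = 0 -> a = 0.
  move=> fa; pose u0 : mod_hom (ker (mod_fun f)) A :=
    (\val : {linear ker _ -> A}).
  have u00 : u0 = 0.
    by apply: (mono0 fm); apply: mod_hom_ext => x; exact: kerP.
  have [x <-] := ker_sub fa.
  exact: (congr1 (fun u : mod_hom _ A => (u : {linear _ -> A}) x) u00).
have [|v vE] := @linear_map R Z A u.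
  move=> a x y; apply/eqP; rewrite -subr_eq0; apply/eqP/finj.
  by rewrite linearB linearP !uE linearP subrr.
by exists v; apply: mod_hom_ext => z; rewrite -[RHS]uE -vE.
Qed.

(** An epimorphism annihilates the map whose kernel is its image. *)
Lemma epi_surjective (A B : Mod R) (f : mor A B) : epi f ->
  forall y, exists x, mod_fun f x = y.
Proof.
move=> fe y; have [J [h [_ hP]]] := image_kernel f; apply/hP.
have -> : h = 0; last by [].
by apply: (epi0 fe); apply: mod_hom_ext => x; apply/hP; exists x.
Qed.

End Algebra.

(** * Free modules *)

Section Free.
Variables (R : pzRingType) (S : choiceType).

Definition free_pred : {pred (S -> R^o)} := fun f =>
  `[< exists s : seq S, forall x, f x != 0 -> x \in s >].
Definition free_module := {f : S -> R^o | free_pred f}.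
HB.instance Definition _ := SubType.on free_module.
HB.instance Definition _ := Choice.on free_module.

Fact free_submod : submod_closed free_pred.
Proof.
split=> [|a f g /asboolP[s sP] /asboolP[t tP]]; apply/asboolP.
  by exists [::] => x; rewrite eqxx.
exists (s ++ t) => x; rewrite mem_cat; apply: contraNT; rewrite negb_or.
move=> /andP[xs xt]; have [/eqP|/sP] := eqVneq (f x) 0;
  last by rewrite (negPf xs).
have [/eqP|/tP] := eqVneq (g x) 0; last by rewrite (negPf xt).
by move=> /eqP gx /eqP fx; rewrite !fctE fx gx scaler0 addr0.
Qed.
HB.instance Definition _ := GRing.isSubmodClosed.Build R (S -> R^o) free_pred
  (GRing.submod_closed_semi free_submod).
HB.instance Definition _ := [SubChoice_isSubLmodule of free_module by <:].

Definition coord (x : S) (f : free_module) : R := \val f x.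

Lemma coord_linear x : linear (coord x : free_module -> R^o).
Proof. by []. Qed.

Lemma free_exists (f : S -> R) (s : seq S) : (forall x, f x != 0 -> x \in s) ->
  exists g : free_module, forall x, coord x g = f x.
Proof.
move=> fs; have fP : free_pred (f : S -> R^o) by apply/asboolP; exists s.
by exists (Sub _ fP).
Qed.

Lemma free_ext (f g : free_module) : (forall x, coord x f = coord x g) -> f = g.
Proof. by move=> fg; apply/val_inj/funext. Qed.

Definition covers (s : seq S) (f : free_module) :=
  forall x, coord x f != 0 -> x \in s.

Lemma covers_sub s t f : {subset s <= t} -> covers s f -> covers t f.
Proof. by move=> st sf x /sf /st. Qed.

Lemma covers_exists f : exists s, uniq s /\ covers s f.
Proof.
have /asboolP[s sf] := valP f; exists (undup s); split; first exact: undup_uniq.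
by move=> x /sf; rewrite mem_undup.
Qed.

Fact delta_fact (x : S) : exists g : free_module, forall y, coord y g =
    (y == x)%:R.
Proof.
apply: (@free_exists (fun y => (y == x)%:R) [:: x]) => y.
by rewrite inE; case: (y =P x) => // _; rewrite eqxx.
Qed.
Definition delta x : free_module := projT1 (cid (delta_fact x)).
Lemma coord_delta x y : coord y (delta x) = (y == x)%:R.
Proof. exact: (projT2 (cid (delta_fact x))). Qed.

Lemma free_sum (f : free_module) s : uniq s -> covers s f ->
  f = \sum_(x <- s) coord x f *: delta x.
Proof.
move=> us sf; apply: free_ext => y.
have coord_sum r : coord y (\sum_(x <- r) coord x f *: delta x)
    = \sum_(x <- r) coord x f * (y == x)%:R.
  elim: r => [|x r IH]; first by rewrite !big_nil.
  rewrite !big_cons -[LHS]/(coord y (coord x f *: delta x) + coord y _) IH.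
  by rewrite -[X in X + _]/(coord x f * coord y (delta x)) coord_delta.
rewrite coord_sum; have [ys|ys] := boolP (y \in s).
  rewrite (bigD1_seq y)//= eqxx mulr1 big1 ?addr0// => x xy.
  by rewrite eq_sym (negPf xy) mulr0.
have /eqP -> : coord y f == 0 by apply: contraNT ys => /sf.
rewrite big_seq big1// => x xs; case: eqP => [yx|]; last by rewrite mulr0.
by rewrite yx xs in ys.
Qed.

Lemma free_lift (M : lmodType R) (v : S -> M) :
  exists f : {linear free_module -> M}, forall x, f (delta x) = v x.
Proof.
have sum_indep (f : free_module) s t : uniq s -> covers s f -> uniq t ->
  covers t f ->
    \sum_(x <- s) coord x f *: v x = \sum_(x <- t) coord x f *: v x.
  have supp r : \sum_(x <- r) coord x f *: v x
      = \sum_(x <- [seq x <- r | coord x f != 0]) coord x f *: v x.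
    rewrite big_filter [LHS](bigID (fun x => coord x f != 0)) /=.
    rewrite [X in _ + X]big1 ?addr0// => x.
    by rewrite negbK => /eqP ->; rewrite scale0r.
  move=> us sf ut tf; rewrite supp [RHS]supp; apply: perm_big.
  apply: uniq_perm; rewrite ?filter_uniq// => x; rewrite !mem_filter.
  by have [|fx] := eqVneq (coord x f) 0; rewrite //= sf// tf.
have [s sP] := dependent_choice covers_exists.
pose F f := \sum_(x <- s f) coord x f *: v x.
have FE f t : uniq t -> covers t f -> F f = \sum_(x <- t) coord x f *: v x.
  by have [us sf] := sP f; exact: sum_indep.
have [|G GE] := @linear_map R free_module M F.
  move=> a f g; pose t := undup (s f ++ s g ++ s (a *: f + g)).
  have tP h : {subset s h <= s f ++ s g ++ s (a *: f + g)} ->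
      F h = \sum_(x <- t) coord x h *: v x.
    move=> st; apply: FE; first exact: undup_uniq.
    by apply: covers_sub (sP h).2 => x /st; rewrite mem_undup.
  rewrite !tP => [|x xs|x xs|x xs]; rewrite ?mem_cat ?xs ?orbT//.
  rewrite scaler_sumr -big_split; apply: eq_bigr => x _ /=.
  by rewrite scalerA -scalerDl.
exists G => x; rewrite GE (@FE _ [:: x])//; last first.
  by move=> y; rewrite coord_delta inE; case: (y =P x) => // _; rewrite eqxx.
by rewrite big_seq1 coord_delta eqxx scale1r.
Qed.

Lemma free_linear_ext (M : lmodType R) (f g : {linear free_module -> M}) :
  (forall x, f (delta x) = g (delta x)) -> forall u, f u = g u.
Proof.
move=> fg u; have [s [us su]] := covers_exists u.
rewrite (free_sum us su) !linear_sum; apply: eq_bigr => x _.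
by rewrite !linearZ fg.
Qed.

End Free.

Lemma free_projective (k : fieldType) (R : pzRingType)
    (iota : {rmorphism k -> R})
  (S : choiceType) : projective (free_module R S : Mod R).
Proof.
move=> A B e ee f.
have /dependent_choice[v vE] x : exists a, mod_fun e a = mod_fun f (delta R x).
  exact: (epi_surjective iota ee).
have [g gE] := free_lift v; exists g; apply: mod_hom_ext.
apply: (@free_linear_ext R S B (mod_fun e \o g : {linear _ -> _}) (mod_fun f))
  => x.
by rewrite /= gE vE.
Qed.

Lemma free_cover (R : pzRingType) (M : Mod R) :
  exists e : mor (free_module R M : Mod R) M, epi e.
Proof.
have [e eE] := @free_lift R M M id; exists e; apply: surjective_epi => y.
by exists (delta R y); exact: eE.
Qed.

(** * Smooth representations *)

Section Representations.
Variables (k : fieldType) (G : topGroupType).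

Section Kernel.
Variables (V W : smooth_rep k G) (f : rep_hom V W).
Local Notation K := (ker (rep_fun f)).

Fact ker_actP g (x : K) : ker_pred (rep_fun f) (rep_act g (\val x)).
Proof. by apply/eqP; rewrite rep_funP kerP rep_act0. Qed.
Definition ker_act g (x : K) : K := Sub _ (ker_actP g x).

Fact ker_act_linear g : linear (ker_act g).
Proof. by move=> a u v; apply: val_inj; rewrite /= rep_act_linear. Qed.
Fact ker_act1 v : ker_act 1%g v = v.
Proof. by apply: val_inj; rewrite /= rep_act1. Qed.
Fact ker_actM g h v : ker_act (g * h)%g v = ker_act g (ker_act h v).
Proof. by apply: val_inj; rewrite /= rep_actM. Qed.
Fact ker_smooth v : open [set g | ker_act g v = v].
Proof.
rewrite (_ : [set g | _] = [set g | rep_act g (\val v) = \val v]).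
  exact: rep_smooth.
by apply/seteqP; split=> g /= => [/(congr1 val)|E] //; exact: val_inj.
Qed.

Definition rep_ker : Rep k G :=
  @SmoothRep k G K ker_act ker_act_linear ker_act1 ker_actM ker_smooth.
End Kernel.

Lemma Rep_has_kernels : has_kernels (Rep k G).
Proof.
move=> V W f.
pose i : rep_hom (rep_ker f) V := @RepHom _ _ (rep_ker f) V
  (\val : {linear ker (rep_fun f) -> V}) (fun g v => erefl).
exists (rep_ker f), i; apply: is_kernelP.
- by apply: rep_hom_ext => x; exact: kerP.
- move=> Z g h gh; apply: rep_hom_ext => x; apply: val_inj.
  exact: (congr1 (fun u : rep_hom Z V => u x) gh).
move=> Z g fg; have [x|h hE] := @ker_lift _ _ _ (rep_fun f) _
  (rep_fun (g : rep_hom Z V)).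
  exact: (congr1 (fun u : rep_hom Z W => u x) fg).
have hG a v : h (rep_act a v) = ker_act a (h v).
  by apply: val_inj; rewrite hE rep_funP /= hE.
by exists (@RepHom _ _ Z (rep_ker f) h hG); apply: rep_hom_ext => x; exact: hE.
Qed.

Section Product.
Variables V W : smooth_rep k G.

Definition prod_act g (x : V * W) : V * W := (rep_act g x.1, rep_act g x.2).
Fact prod_act_linear g : linear (prod_act g).
Proof. by move=> a u v; apply: injective_projections;
  exact: rep_act_linear. Qed.
Fact prod_act1 v : prod_act 1%g v = v.
Proof. by apply: injective_projections; exact: rep_act1. Qed.
Fact prod_actM g h v : prod_act (g * h)%g v = prod_act g (prod_act h v).
Proof. by apply: injective_projections; exact: rep_actM. Qed.
Fact prod_smooth v : open [set g | prod_act g v = v].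
Proof.
rewrite (_ : [set g | _] =
  [set g | rep_act g v.1 = v.1] `&` [set g | rep_act g v.2 = v.2]).
  by apply: openI; exact: rep_smooth.
apply/seteqP; split=> g /= => [E|[E1 E2]]; last exact: injective_projections.
by split; [exact: (congr1 fst E) | exact: (congr1 snd E)].
Qed.

Definition rep_prod : Rep k G := @SmoothRep k G (V * W)%type
  prod_act prod_act_linear prod_act1 prod_actM prod_smooth.
End Product.

Lemma Rep_has_biproducts : has_biproducts (Rep k G).
Proof.
move=> V W; pose S := rep_prod V W.
have inlG g v : pair_inl V W (rep_act g v) = rep_act g (pair_inl V W v : S).
  by apply: injective_projections => //=; rewrite rep_act0.
have inrG g v : pair_inr V W (rep_act g v) = rep_act g (pair_inr V W v : S).
  by apply: injective_projections => //=; rewrite rep_act0.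
exists S, (@RepHom _ _ V S (pair_inl V W) inlG),
  (@RepHom _ _ W S (pair_inr V W) inrG),
  (@RepHom _ _ S V (fst : {linear (V * W)%type -> V}) (fun _ _ => erefl)),
  (@RepHom _ _ S W (snd : {linear (V * W)%type -> W}) (fun _ _ => erefl)).
split; apply: rep_hom_ext => //= -[a b].
by apply: injective_projections; rewrite /= ?addr0 ?add0r.
Qed.

End Representations.

(** * Tensor product with the universal representation *)

Section Hecke.
Variables (k : fieldType) (G : topGroupType) (J : open_subgroup G).
Local Notation X := (indX k J).
Local Notation H := (Hecke k J).
Local Notation U := (functorU k J).

Definition hom_of (V : Rep k G) (phi : U V) : rep_hom X V := phi.

Section Scalars.
(** Through these [H] is an algebra over [k], so that [H]-modules can be
    coinduced from vector spaces. *)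
Definition scalar_hom (a : k) : rep_hom X X :=
  @RepHom k G X X (a \*: (idfun : {linear X -> X}))
    (fun g v => esym (rep_actZ g a v)).

Definition scalar (a : k) : H := scalar_hom a.

Fact scalar_zmod : zmod_morphism scalar.
Proof. by move=> a b; apply: rep_hom_ext => x; exact: scalerBl. Qed.
Fact scalar_monoid : monoid_morphism scalar.
Proof.
split=> [|a b]; apply: rep_hom_ext => x; first exact: scale1r.
by rewrite [RHS]scalerA mulrC.
Qed.
HB.instance Definition _ := GRing.isZmodMorphism.Build k H scalar scalar_zmod.
HB.instance Definition _ := GRing.isMonoidMorphism.Build k H scalar
  scalar_monoid.
End Scalars.

Section Adjunction.
Variable P : lmodType H.
Local Notation FP := (functorF P).

Lemma tens0l m : tens (0 : X) m = 0 :> FP.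
Proof.
have [bDl _ _] := @tens_balanced k G J P.
by apply: (addrI (tens 0 m)); rewrite -bDl !addr0.
Qed.

Lemma tens0r x : tens x (0 : P) = 0 :> FP.
Proof.
have [_ bDr _] := @tens_balanced k G J P.
by apply: (addrI (tens x 0)); rewrite -bDr !addr0.
Qed.

Lemma tens_suml (I : Type) (r : seq I) (F : I -> X) (m : P) :
  tens (\sum_(i <- r) F i) m = \sum_(i <- r) tens (F i) m :> FP.
Proof.
have [bDl _ _] := @tens_balanced k G J P.
by apply: (big_morph (fun x => tens x m)) => [x y|];
  [exact: bDl | exact: tens0l].
Qed.

Lemma tens_sumr (I : Type) (r : seq I) (F : I -> P) (x : X) :
  tens x (\sum_(i <- r) F i) = \sum_(i <- r) tens x (F i) :> FP.
Proof.
have [_ bDr _] := @tens_balanced k G J P.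
by apply: (big_morph (tens x)) => [u v|]; [exact: bDr | exact: tens0r].
Qed.

Lemma tens_mulr (x : X) (h : H) (m : P) : tens (X_mulr x h) m = tens x (h *: m)
    :> FP.
Proof. by have [_ _ ->] := @tens_balanced k G J P. Qed.

Lemma tens_hom_ext (V : Rep k G) (f g : rep_hom FP V) :
  (forall x m, f (tens x m) = g (tens x m)) -> f = g.
Proof.
move=> fg; apply: rep_hom_ext => t; rewrite (tens_gen t) /tens_eval !linear_sum.
by apply: eq_bigr => xm _; exact: fg.
Qed.

Lemma F_adjoint (V : Rep k G) (h : {linear P -> U V}) :
  exists f : rep_hom FP V, forall x m, f (tens x m) = hom_of (h m) x.
Proof.
have bb : balanced (fun x m => hom_of (h m) x).
  split=> [x x' m|x m m'|x a m]; first exact: linearD.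
    by rewrite linearD.
  by rewrite linearZ.
have [f [[fB fE] _]] := tensorP bb.
have f0 : f 0 = 0 by have := fB 0 0; rewrite !subrr.
have fD u v : f (u + v) = f u + f v.
  by have := fB (u + v) v; rewrite addrK => ->; rewrite subrK.
have f_sum s : f (\sum_(xm <- s) tens xm.1 xm.2)
    = \sum_(xm <- s) hom_of (h xm.2) xm.1.
  by rewrite (big_morph f fD f0); apply: eq_bigr => xm _.
have [|F FE] := @linear_map k FP V f.
  move=> a u v; rewrite fD; congr (_ + _).
  rewrite (tens_gen u) /tens_eval scaler_sumr f_sum scaler_sumr.
  rewrite (big_morph f fD f0); apply: eq_bigr => xm _.
  by rewrite tens_scaleE fE linearZ.
have FG g v : F (rep_act g v) = rep_act g (F v).
  rewrite !FE (tens_gen v) /tens_eval f_sum.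
  rewrite !(big_morph _ (@rep_actD _ _ _ g) (@rep_act0 _ _ _ g)).
  rewrite (big_morph f fD f0); apply: eq_bigr => xm _.
  by rewrite tens_actE fE rep_funP.
by exists (RepHom FG) => x m; rewrite /= FE.
Qed.

Lemma unit_exists : exists eta : {linear P -> U FP},
  forall m x, hom_of (eta m) x = tens x m.
Proof.
have [bDl bDr bM] := @tens_balanced k G J P.
have /dependent_choice[e eE] m : exists e : U FP, forall x, hom_of e x = tens x
  m.
  have [|l lE] := @linear_map k X FP (fun x => tens x m).
    by move=> a x y; rewrite bDl tens_scaleE.
  have lG g x : l (rep_act g x) = rep_act g (l x) by rewrite !lE tens_actE.
  by exists (RepHom lG).
have [|eta etaE] := @linear_map H P (U FP) e;
  last by exists eta => m x; rewrite etaE.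
move=> a m m'; apply: rep_hom_ext => x.
rewrite -[LHS]/(hom_of (e _) x) eE bDr -bM.
by rewrite -[RHS]/(hom_of (e m) (X_mulr x a) + hom_of (e m') x) !eE.
Qed.

Definition unitF : mor (P : Mod H) (U FP) := projT1 (cid unit_exists).
Lemma unitFE m x : hom_of (mod_fun unitF m) x = tens x m.
Proof. exact: (projT2 (cid unit_exists)). Qed.

Lemma F_universal (V : Rep k G) (h : mor (P : Mod H) (U V)) :
  exists! f : mor (FP : Rep k G) V, fmap U f \oc unitF = h.
Proof.
have [f fE] := F_adjoint (mod_fun h); exists f; split=> [|f' f'E].
  apply: mod_hom_ext => m; apply: rep_hom_ext => x.
  rewrite -[LHS]/(f (hom_of (mod_fun unitF m) x)) unitFE fE.
  by [].
apply: tens_hom_ext => x m; rewrite fE -f'E.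
by rewrite -[LHS]/((f' : rep_hom _ _) (hom_of (mod_fun unitF m) x)) unitFE.
Qed.

End Adjunction.

Definition unit_iso (P : Mod H) :=
  exists rho : mor (U (functorF P)) P,
    rho \oc unitF P = idm P /\ unitF P \oc rho = idm (U (functorF P)).

Lemma F_ext (P : Mod H) (V : Rep k G) (f g : mor (functorF P : Rep k G) V) :
  fmap U f \oc unitF P = fmap U g \oc unitF P -> f = g.
Proof.
move=> fg; have [f' [_ f'u]] := F_universal (fmap U f \oc unitF P).
by rewrite -(f'u f)// (f'u g).
Qed.

(** By naturality of the unit; [F] on morphisms is given by [F_universal]. *)
Lemma unit_iso_retract (P L : Mod H) (s : mor P L) (r : mor L P) :
  r \oc s = idm P -> unit_iso L -> unit_iso P.
Proof.
move=> rs [rho [rho1 rho2]].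
have [Fs [FsE _]] := F_universal (unitF L \oc s).
have [Fr [FrE _]] := F_universal (unitF P \oc r).
have Frs : Fr \oc Fs = idm _.
  apply: F_ext; rewrite fmapM -compA FsE compA FrE -compA rs compm1.
  by rewrite fmap1 comp1m.
exists (r \oc rho \oc fmap U Fs); split.
  by rewrite -compA FsE compA -[r \oc _ \oc _]compA rho1 compm1.
rewrite !compA -FrE -[fmap U Fr \oc _ \oc _]compA rho2 compm1.
by rewrite -fmapM Frs fmap1.
Qed.

(** Maps out of [F P] are maps out of [P] by adjunction, hence maps out of
    [U F P]. *)
Lemma unit_iso_U_projective (P : Mod H) : projective P -> unit_iso P ->
  U_projective U (functorF P).
Proof.
move=> Pp [rho [rho1 rho2]]; split=> [|W h].
  exact: retract_projective rho2 Pp.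
have [f [fE fu]] := F_universal (h \oc unitF P); exists f; split=> [|g gE].
  by rewrite -[fmap U f]compm1 -rho2 compA fE -compA rho2 compm1.
by apply: fu; rewrite gE.
Qed.

Section FreeUnit.
Hypothesis J_compact : compact (osubg J).
Variable S : choiceType.
Let L : lmodType H := free_module H S.

Lemma coord_hom (s : S) : exists f : rep_hom (functorF L) X,
  forall x l, f (tens x l) = (coord s l : rep_hom X X) x.
Proof.
have [c cE] := @linear_map H L (U X) (coord s) (@coord_linear H S s).
by have [f fE] := F_adjoint c; exists f => x l; rewrite fE cE.
Qed.

(** [F L] is a direct sum of copies of [X]. A map from [X] to it has only
    finitely many nonzero coordinates, since it is determined by the image of
    the generator [ind1] of [X], and these coordinates are an element of [L]. *)
Lemma free_unit_iso : unit_iso (L : Mod H).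
Proof.
have [pi piE] := dependent_choice coord_hom.
have pi_unit s l x : pi s (hom_of (mod_fun (unitF L) l) x)
    = (coord s l : rep_hom X X) x by rewrite unitFE piE.
(* The coordinates of a tensor with respect to the basis of [L]. *)
have expand (t : functorF L) : exists c : seq S,
    (forall s, s \notin c -> pi s t = 0) /\
    t = \sum_(s <- c) tens (pi s t) (delta H s).
  have [c [uc cP]] : exists c, uniq c /\
      forall xm, xm \in repr t -> covers c xm.2.
    elim: (repr t) => [|xm r [c [_ cP]]]; first by exists [::].
    have [c' [_ c'P]] := covers_exists xm.2.
    exists (undup (c ++ c')); split=> [|ym]; first exact: undup_uniq.
    rewrite inE => /predU1P[->|/cP ymc].
      by apply: covers_sub c'P => s sc; rewrite mem_undup mem_cat sc orbT.
    by apply: covers_sub ymc => s sc; rewrite mem_undup mem_cat sc.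
  have piT s : pi s t = \sum_(xm <- repr t) (coord s xm.2 : rep_hom X X) xm.1.
    rewrite [in LHS](tens_gen t) /tens_eval linear_sum.
    by apply: eq_bigr => xm _; exact: piE.
  exists c; split=> [s sc|].
    rewrite piT big_seq big1// => xm /cP xmc.
    have /eqP -> : coord s xm.2 == 0 by apply: contraNT sc => /xmc.
    by [].
  under eq_bigr do rewrite piT tens_suml.
  rewrite exchange_big [LHS](tens_gen t) /tens_eval big_seq [RHS]big_seq.
  apply: eq_bigr => xm xmt; rewrite [in LHS](free_sum uc (cP _ xmt)) tens_sumr.
  by apply: eq_bigr => s _; rewrite -tens_mulr.
have jointly_inj (t t' : functorF L) : (forall s, pi s t = pi s t') -> t = t'.
  move=> tt'; apply/eqP; rewrite -subr_eq0; have [c [_ ->]] := expand (t - t').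
  rewrite big1// => s _; rewrite linearB tt' subrr.
  exact: tens0l.
have unit_inj l : mod_fun (unitF L) l = 0 -> l = 0.
  move=> l0; apply: free_ext => s; apply: rep_hom_ext => x.
  by rewrite -[LHS]pi_unit l0 linear0.
have unit_surj phi : exists l, mod_fun (unitF L) l = phi.
  pose ind1J := @ind1 k G J J_compact.
  have [c [cP _]] := expand (hom_of phi ind1J).
  have [|l lE] := @free_exists H S
    (fun s => rep_comp (pi s) (hom_of phi) : H) c.
    move=> s; apply: contraNT => sc; apply/eqP.
    by apply: (frobenius_inj (J_compact := J_compact)); rewrite /= cP.
  exists l; apply: rep_hom_ext => x; apply: jointly_inj => s.
  by rewrite -[LHS]/(pi s (hom_of _ x)) pi_unit lE.
have [r rE] := dependent_choice unit_surj.
have [|rho rhoE] := @linear_map H (U (functorF L)) L r.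
  move=> a u v; apply/eqP; rewrite -subr_eq0; apply/eqP/unit_inj.
  by rewrite linearB rE linearP !rE subrr.
exists rho; split; apply: mod_hom_ext => l; last first.
  by rewrite -[LHS]/(mod_fun (unitF L) (rho l)) rhoE rE.
rewrite -[LHS]/(rho (mod_fun (unitF L) l)) rhoE.
by apply/eqP; rewrite -subr_eq0; apply/eqP/unit_inj; rewrite linearB rE subrr.
Qed.

End FreeUnit.

Section Projectives.
Hypothesis J_compact : compact (osubg J).

Lemma projective_unit_iso (P : Mod H) : projective P -> unit_iso P.
Proof.
move=> Pp; have [e ee] := free_cover P; have [s es] := Pp _ _ e ee (idm P).
exact: unit_iso_retract es (free_unit_iso J_compact P).
Qed.

Lemma I_projective_U_projective (V : Rep k G) : I_projective J V ->
    U_projective U V.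
Proof.
move=> [P [Pp [B [iA [iB [pA [pB [pi _ _ _ _]]]]]]]].
apply: U_projective_retract pi _.
exact/unit_iso_U_projective/projective_unit_iso.
Qed.

Lemma F_free_U_projective (S : choiceType) :
  U_projective U (functorF (free_module H S)).
Proof.
apply: unit_iso_U_projective; last exact: free_unit_iso.
exact: free_projective scalar S.
Qed.

Lemma enough_U_projectives (Z : Mod H) : exists S : choiceType,
  exists e : mor (U (functorF (free_module H S))) Z, epi e.
Proof.
exists Z; have [e ee] := free_cover Z.
have [rho [rho1 rho2]] := free_unit_iso J_compact Z.
exists (e \oc rho); apply: epiP => W w we; apply: (epi0 ee).
by rewrite -[e]compm1 -rho1 !compA -[w \oc _ \oc _]compA we comp0m.
Qed.

End Projectives.
End Hecke.

Theorem corollary4p9 (k : fieldType) (p : nat) (hp : p \in [pchar k]%R)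
    (G : topGroupType) (I : open_subgroup G) (hI : pro_p p I)
    (V W : Ch (Rep k G)) (i : mor V W) :
  cof (I_singular_projective k I) i <->
  (forall n, split_mono (at_deg i n)) /\
  (exists (C : Ch (Rep k G)) (q : mor W C),
     is_cokernel i q /\ I_exact I C /\ forall n, I_projective I (C n)).
Proof.
have I_compact : compact (osubg I) by have [[]] := hI.
have hkR := @Rep_has_kernels k G; have hbR := @Rep_has_biproducts k G.
have hkM := @Mod_has_kernels (Hecke k I).
have hbM := @Mod_has_biproducts (Hecke k I).
have hN := @Mod_normal k (Hecke k I) (scalar I).
split=> [i_cof|[i_split [C [q [qc [Cex Cp]]]]]]; last first.
  move=> Y Z f f_fib f_weq; apply: (split_mono_lifts hkR i_split qc _ Cex).
    by move=> n; exact: I_projective_U_projective.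
  exact: weq_trivial_fibration.
have i_lifts : lifts_trivial_fibrations (functorU k I) i.
  by move=> Y Z f /(trivial_fibration_weq hkM hbM)[]; exact: i_cof.
have i_split := lifts_split_mono hkR hbR i_lifts; split=> //.
have /dependent_choice[r ri] := i_split.
have [C [q [_ [qc _]]]] := split_cokernel_exists hkR ri.
have Cp n : I_projective I (C n).
  have /dependent_choice[S /dependent_choice[e ee]] :=
    fun n => enough_U_projectives I_compact (functorU k I (C n)).
  have /dependent_choice[g gE] m : exists
    g : mor (functorF (free_module _ (S m))) (C m),
      fmap (functorU k I) g = e m.
    exact/U_full/F_free_U_projective.
  have [|s gs] := lifts_cokernel_retract hkR hbR i_lifts qc (g := g) _ n.
    by move=> m; rewrite gE.
  exists (free_module (Hecke k I) (S n) : Mod (Hecke k I)); split;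
    first exact: free_projective (scalar I) _.
  exact: retract_summand hkR gs.
exists C, q; split=> //; split=> //.
apply: (lifts_acyclic hkR hbR hkM i_lifts qc) => [Z|A B f|n].
- have [S [e ee]] := enough_U_projectives I_compact Z.
  exists (functorF (free_module (Hecke k I) S)); split; last by exists e.
  exact: F_free_U_projective.
- by have [J [h hP]] := image_kernel (scalar I) f; exists J, h.
- exact: I_projective_U_projective.
Qed.
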